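(* Let $R$ be a commutative noetherian ring and let $\mathcal{M}$ be a Serre subcategory of $R\text{-}\mathrm{Mod}$ which is closed under taking injective hulls. Then the following conditions are equivalent: (1) $\mathcal{S}_{f.g.}*\mathcal{M}$ is a Melkersson subcategory; (2) At least one of the following two conditions holds: (a) $\dim R=0$; (b) all prime ideals $\mathfrak{p}$ of $R$ with $\mathrm{ht}\,\mathfrak{p}=1$ belong to $\mathrm{Supp}_R(\mathcal{M})$.
   Context: All rings are commutative noetherian and all modules are unitary. $R\text{-}\mathrm{Mod}$ is the category of all $R$-modules; subcategories are full and closed under isomorphisms. A Serre subcategory of $R\text{-}\mathrm{Mod}$ is a (nonempty) subcategory closed under taking submodules, quotient modules and extensions. For an ideal $I$ of $R$ and an $R$-module $M$, $\Gamma_I(M)=\{x\in M \mid I^n x=0 \text{ for some } n\geq 1\}$ and $(0:_M I)=\{x\in M\mid Ix=0\}$. A Serre subcategory $\mathcal{S}$ satisfies the Melkersson condition $(C_I)$ if: for every $R$-module $M$, if $\Gamma_I(M)=M$ and $(0:_M I)\in\mathcal{S}$, then $M\in\mathcal{S}$. A Serre subcategory is a Melkersson subcategory if it satisfies $(C_I)$ for all ideals $I$ of $R$. For a subcategory $\mathcal{X}$, $\mathrm{Supp}_R(\mathcal{X})=\bigcup_{M\in\mathcal{X}}\mathrm{Supp}_R(M)$. $\mathcal{S}_{f.g.}$ is the subcategory of finitely generated $R$-modules. For Serre subcategories $\mathcal{S}_1,\mathcal{S}_2$, $\mathcal{S}_1*\mathcal{S}_2$ is the subcategory of $R$-modules $M$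 for which there is a short exact sequence $0\to S_1\to M\to S_2\to 0$ with $S_i\in\mathcal{S}_i$. It is known that $\mathcal{S}_{f.g.}*\mathcal{S}$ is a Serre subcategory for every Serre subcategory $\mathcal{S}$. *)

(* Defs.v *)
From HB Require Import structures.
From mathcomp Require Import all_boot all_order all_algebra generic_quotient.
From mathcomp Require Import ring.
From mathcomp Require Import boolp classical_sets constructive_ereal.

Set Implicit Arguments.
Unset Strict Implicit.
Unset Printing Implicit Defensive.

Import Order.TTheory GRing.Theory Num.Theory.
Local Open Scope ring_scope.
Local Open Scope quotient_scope.

(* Rings are comPzRingType, so the zero ring is allowed.  Since {pred T} is    *)
(* T -> bool and boolp embeds Prop in bool, boolean predicates represent       *)
(* arbitrary subsets.                                                          *)

Definition spans (R : pzRingType) (M : lmodType R) (s : seq M) (x : M) : Prop :=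
  exists c : nat -> R, x = \sum_(i < size s) c i *: s`_i.

Definition fin_gen (R : pzRingType) (M : lmodType R) : Prop :=
  exists s : seq M, forall x : M, spans s x.

Section Ideals.
Variable R : comPzRingType.

Definition is_ideal (I : {pred R}) : Prop :=
  GRing.submod_closed (I : {pred R^o}).

Definition noetherian : Prop :=
  forall I : {pred R}, is_ideal I ->
    exists s : seq R^o, forall x : R^o, x \in I <-> spans s x.

Definition ideal_mul (I J : {pred R}) : {pred R} := fun x =>
  `[< exists2 s : seq (R * R), all (fun u => (u.1 \in I) && (u.2 \in J)) s &
        x = \sum_(u <- s) u.1 * u.2 >].

Definition ideal_exp (I : {pred R}) (n : nat) : {pred R} :=
  iter n (ideal_mul I) predT.

Record spec := Spec {
  spec_val :> {pred R};
  spec_ideal : is_ideal spec_val;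
  spec_proper : 1 \notin spec_val;
  spec_mem_mul : forall a b : R,
    a * b \in spec_val -> (a \in spec_val) || (b \in spec_val)
}.

Definition strict_sub (p q : spec) : Prop :=
  {subset p <= q} /\ ~ {subset q <= p}.

(* c 0, ..., c n is a strict chain of primes of length n; the values of c      *)
(* beyond n play no role.                                                      *)
Definition prime_chain (n : nat) (c : nat -> spec) : Prop :=
  forall i, (i < n)%N -> strict_sub (c i) (c i.+1).

(* In \bar int every set has a supremum; that of the empty set is -oo, which   *)
(* makes the dimension of the zero ring -oo.                                   *)
Definition sup_nat (A : set nat) : \bar int :=
  supremum -oo%E [set (n%:Z)%:E | n in A]%classic.

Definition krull_dim : \bar int :=
  sup_nat [set n | exists c, prime_chain n c]%classic.

Definition height (p : spec) : \bar int :=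
  sup_nat [set n | exists2 c, prime_chain n c & c n = p]%classic.

End Ideals.

Section Localization.
Variables (R : comPzRingType) (p : spec R) (M : lmodType R).

Lemma spec_compl1 : 1 \notin spec_val p.
Proof. exact: spec_proper. Qed.

Lemma spec_complM (s t : R) :
  s \notin spec_val p -> t \notin spec_val p -> s * t \notin spec_val p.
Proof.
by move=> sp tp; apply/negP => /spec_mem_mul; rewrite (negPf sp) (negPf tp).
Qed.

Definition denom := {s : R | s \notin spec_val p}.

Definition denom1 : denom := exist _ 1 spec_compl1.

Definition denomM (s t : denom) : denom :=
  exist _ (sval s * sval t) (spec_complM (svalP s) (svalP t)).

Definition fraction := (M * denom)%type.

Definition frac_eqv : rel fraction := fun u v =>
  `[< exists2 w : R, w \notin spec_val p &
        w *: (sval v.2 *: u.1) = w *: (sval u.2 *: v.1) >].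

Lemma frac_eqv_refl : reflexive frac_eqv.
Proof. by move=> u; apply/asboolP; exists 1 => //; exact: spec_compl1. Qed.

Lemma frac_eqv_sym : symmetric frac_eqv.
Proof. by move=> u v; apply/asboolP/asboolP => -[w wp e]; exists w. Qed.

Lemma frac_eqv_trans : transitive frac_eqv.
Proof.
move=> v u t /asboolP[w wp e1] /asboolP[w' w'p e2]; apply/asboolP.
exists (w * w' * sval v.2).
  by apply: spec_complM; [exact: spec_complM | exact: (svalP v.2)].
transitivity ((w' * sval t.2) *: (w *: (sval v.2 *: u.1))).
  by rewrite !scalerA; congr (_ *: _); ring.
rewrite e1; transitivity ((w * sval u.2) *: (w' *: (sval t.2 *: v.1))).
  by rewrite !scalerA; congr (_ *: _); ring.
by rewrite e2 !scalerA; congr (_ *: _); ring.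
Qed.

Canonical frac_equiv :=
  EquivRel frac_eqv frac_eqv_refl frac_eqv_sym frac_eqv_trans.

(* M_p is built as an R-module only: Supp just asks whether it is nonzero.     *)
Definition local_mod := {eq_quot frac_equiv}.

HB.instance Definition _ := Choice.on local_mod.
HB.instance Definition _ := EqQuotient.on local_mod.

Lemma frac_eqP (u v : fraction) :
  reflect (exists2 w : R, w \notin spec_val p &
             w *: (sval v.2 *: u.1) = w *: (sval u.2 *: v.1))
          (\pi_local_mod u == \pi_local_mod v).
Proof. by rewrite eqmodE; exact: asboolP. Qed.

Definition frac_add (u v : fraction) : fraction :=
  (sval v.2 *: u.1 + sval u.2 *: v.1, denomM u.2 v.2).
Definition frac_opp (u : fraction) : fraction := (- u.1, u.2).
Definition frac_scale (a : R) (u : fraction) : fraction := (a *: u.1, u.2).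

Definition local_zero : local_mod := \pi_local_mod (0, denom1).
Definition local_add (x y : local_mod) : local_mod :=
  \pi_local_mod (frac_add (repr x) (repr y)).
Definition local_opp (x : local_mod) : local_mod :=
  \pi_local_mod (frac_opp (repr x)).
Definition local_scale (a : R) (x : local_mod) : local_mod :=
  \pi_local_mod (frac_scale a (repr x)).

Lemma local_addE u v :
  local_add (\pi_local_mod u) (\pi_local_mod v) = \pi_local_mod (frac_add u v).
Proof.
apply/eqP/frac_eqP => /=.
have /eqP/frac_eqP[w wp e] := reprK (\pi_local_mod u).
have /eqP/frac_eqP[w' w'p e'] := reprK (\pi_local_mod v).
move: (repr (\pi_local_mod u)) (repr (\pi_local_mod v)) e e' => u' v' e e'.
exists (w * w'); first exact: spec_complM.
transitivity ((w' * sval v.2 * sval v'.2) *: (w *: (sval u.2 *: u'.1)) +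
              (w * sval u.2 * sval u'.2) *: (w' *: (sval v.2 *: v'.1))).
  by rewrite !scalerDr !scalerA; congr (_ *: _ + _ *: _); ring.
by rewrite e e' !scalerDr !scalerA; congr (_ *: _ + _ *: _); ring.
Qed.

Lemma local_oppE u : local_opp (\pi_local_mod u) = \pi_local_mod (frac_opp u).
Proof.
apply/eqP/frac_eqP => /=.
have /eqP/frac_eqP[w wp e] := reprK (\pi_local_mod u).
by exists w => //; rewrite !scalerN e.
Qed.

Lemma local_scaleE a u :
  local_scale a (\pi_local_mod u) = \pi_local_mod (frac_scale a u).
Proof.
apply/eqP/frac_eqP => /=.
have /eqP/frac_eqP[w wp e] := reprK (\pi_local_mod u).
move: (repr (\pi_local_mod u)) e => u' e; exists w => //.
transitivity (a *: (w *: (sval u.2 *: u'.1))).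
  by rewrite !scalerA; congr (_ *: _); ring.
by rewrite e !scalerA; congr (_ *: _); ring.
Qed.

Lemma local_addA : associative local_add.
Proof.
elim/quotW => u; elim/quotW => v; elim/quotW => t.
rewrite (local_addE v t) (local_addE u v) !local_addE.
apply/eqP/frac_eqP; exists 1; rewrite ?spec_compl1 //=.
by rewrite !scalerDr !scalerA !addrA; congr (_ *: _ + _ *: _ + _ *: _); ring.
Qed.

Lemma local_addC : commutative local_add.
Proof.
elim/quotW => u; elim/quotW => v; rewrite !local_addE.
apply/eqP/frac_eqP; exists 1; rewrite ?spec_compl1 //=.
by rewrite [in RHS]addrC [sval v.2 * _]mulrC.
Qed.

Lemma local_add0 : left_id local_zero local_add.
Proof.
elim/quotW => u; rewrite local_addE.
apply/eqP/frac_eqP; exists 1; rewrite ?spec_compl1 //=.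
by rewrite scaler0 add0r !scale1r mul1r.
Qed.

Lemma local_addN : left_inverse local_zero local_opp local_add.
Proof.
elim/quotW => u; rewrite (local_oppE u) local_addE.
apply/eqP/frac_eqP; exists 1; rewrite ?spec_compl1 //=.
by rewrite scalerN addNr !scaler0.
Qed.

HB.instance Definition _ := GRing.isZmodule.Build local_mod
  local_addA local_addC local_add0 local_addN.

Lemma local_scaleA a b x :
  local_scale a (local_scale b x) = local_scale (a * b) x.
Proof.
elim/quotW: x => u; rewrite (local_scaleE b u) !local_scaleE.
by congr (\pi_local_mod (_, _)); rewrite /= scalerA.
Qed.

Lemma local_scale1 : left_id 1 local_scale.
Proof.
elim/quotW => u; rewrite local_scaleE.
by case: u => x s; rewrite /frac_scale scale1r.
Qed.

Lemma local_scaleDr : right_distributive local_scale +%R.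
Proof.
move=> a; elim/quotW => u; elim/quotW => v.
rewrite -[_ + _]/(local_add _ _) -[RHS]/(local_add _ _).
rewrite (local_addE u v) (local_scaleE a u) (local_scaleE a v).
rewrite local_scaleE local_addE.
apply/eqP/frac_eqP; exists 1; rewrite ?spec_compl1 //=.
by rewrite !scalerDr !scalerA; congr (_ *: _ + _ *: _); ring.
Qed.

Lemma local_scaleDl x : {morph local_scale^~ x : a b / a + b}.
Proof.
elim/quotW: x => u a b.
rewrite -[RHS]/(local_add _ _) (local_scaleE a u) (local_scaleE b u).
rewrite local_scaleE local_addE.
apply/eqP/frac_eqP; exists 1; rewrite ?spec_compl1 //=.
by rewrite !scalerDr !scalerA -!scalerDl; congr (_ *: _); ring.
Qed.

HB.instance Definition _ := GRing.Zmodule_isLmodule.Build R local_mod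
  local_scaleA local_scale1 local_scaleDr local_scaleDl.

Definition in_supp : Prop := exists x : local_mod, x != 0.

End Localization.

Section Torsion.
Variables (R : comPzRingType) (M : lmodType R).

Definition torsion (I : {pred R}) : {pred M} := fun x =>
  `[< exists2 n, (0 < n)%N & {in ideal_exp I n, forall a, a *: x = 0} >].

Definition annihilated (I : {pred R}) : {pred M} := fun x =>
  `[< {in I, forall a, a *: x = 0} >].

Lemma annihilated_submod_closed I : GRing.submod_closed (annihilated I).
Proof.
split=> [|b x y /asboolP Ix /asboolP Iy].
  by apply/asboolP => a _; rewrite scaler0.
apply/asboolP => a Ia.
by rewrite scalerDr scalerA mulrC -scalerA Ix // Iy // scaler0 addr0.
Qed.

HB.instance Definition _ I := GRing.isSubmodClosed.Build R M (annihilated I)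
  (annihilated_submod_closed I).

(* (0 :_M I) as an R-module. *)
Definition annih_mod (I : {pred R}) := {x : M | x \in annihilated I}.

HB.instance Definition _ I := SubChoice.on (annih_mod I).
HB.instance Definition _ I := [SubChoice_isSubLmodule of annih_mod I by <:].

End Torsion.

Section Subcategories.
Variable R : comPzRingType.
Implicit Types S : lmodType R -> Prop.

Definition short_exact (A B C : lmodType R)
    (f : {linear A -> B}) (g : {linear B -> C}) : Prop :=
  [/\ injective f, forall y, g y = 0 <-> exists x, f x = y &
      forall z, exists y, g y = z].

(* Submodules and quotients are taken up to isomorphism, as injective and      *)
(* surjective linear maps.                                                     *)
Record serre S : Prop := Serre {
  serre_nonempty : exists A, S A;
  serre_iso : forall (A B : lmodType R) (f : {linear A -> B}),
    bijective f -> S A -> S B;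
  serre_sub : forall (A B : lmodType R) (f : {linear A -> B}),
    injective f -> S B -> S A;
  serre_quot : forall (A B : lmodType R) (g : {linear A -> B}),
    (forall y, exists x, g x = y) -> S A -> S B;
  serre_ext : forall (A B C : lmodType R)
      (f : {linear A -> B}) (g : {linear B -> C}),
    short_exact f g -> S A -> S C -> S B
}.

Definition melkersson_cond S (I : {pred R}) : Prop :=
  forall M : lmodType R, (forall x : M, x \in torsion I) ->
    S (annih_mod M I) -> S M.

Definition melkersson S : Prop :=
  serre S /\ forall I : {pred R}, is_ideal I -> melkersson_cond S I.

Definition subcat_ext (S1 S2 : lmodType R -> Prop) (M : lmodType R) : Prop :=
  exists (A B : lmodType R) (f : {linear A -> M}) (g : {linear M -> B}),
    [/\ short_exact f g, S1 A & S2 B].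

Definition subcat_supp S (p : spec R) : Prop :=
  exists2 M : lmodType R, S M & in_supp p M.

Definition injective_module (E : lmodType R) : Prop :=
  forall (A B : lmodType R) (f : {linear A -> B}) (g : {linear A -> E}),
    injective f -> exists h : {linear B -> E}, forall x, h (f x) = g x.

Definition essential (M E : lmodType R) (i : {linear M -> E}) : Prop :=
  forall N : {pred E}, GRing.submod_closed N ->
    (exists2 y, y \in N & y != 0) -> exists2 x, i x \in N & i x != 0.

Definition injective_hull (M E : lmodType R) (i : {linear M -> E}) : Prop :=
  [/\ injective i, injective_module E & essential i].

Definition closed_injective_hull S : Prop :=
  forall (M E : lmodType R) (i : {linear M -> E}),
    injective_hull i -> S M -> S E.

End Subcategories.

(* Main.v *)
(* For a prime q strictly below p and x in p but not in q, put D = R/q.  In   *)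
(* the x-torsion module X = D[1/x]/D the submodule (0 : x) = D/xD is cyclic,  *)
(* so the Melkersson condition puts X in S_fg * M; dividing X by a finitely   *)
(* generated submodule, which is killed by some x^n, leaves the class of      *)
(* 1/x^(n+1) with annihilator inside p, whence p is in Supp M.                *)
(*                                                                            *)
(* Conversely, by Krull's principal ideal theorem and prime avoidance every   *)
(* non-minimal prime contains a prime of height one, so only minimal primes   *)
(* may lie outside Supp M.  Let X be I-torsion with (0 : I) in S_fg * M, and  *)
(* let T be the submodule of all x with Rx in M.  The submodule (0 :_T I) is  *)
(* in M, and T is an essential extension of it, so T is in M by closure under *)
(* injective hulls.  A product of N primes vanishes in R, and locally at the  *)
(* minimal primes containing I this yields I^N X <= T.  Finally (L :_X I) is  *)
(* in S_fg * M whenever L and (0 :_X I) are, by induction on the generators   *)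
(* of I; starting from T, N such steps reach X.                               *)
From HB Require Import structures.
From Stdlib Require List.
Require Import Defs.
From mathcomp Require Import all_boot all_order all_algebra generic_quotient.
From mathcomp Require Import ring.
From mathcomp Require Import boolp classical_sets functions constructive_ereal.

Set Implicit Arguments.
Unset Strict Implicit.
Unset Printing Implicit Defensive.

Import Order.TTheory GRing.Theory Num.Theory.
Local Open Scope ring_scope.

(** * Submodules and quotient modules *)

Section Submodules.
Variable R : comPzRingType.

(** A prime of height one has a prime strictly below it, so in dimension 0 condition (b) holds
    vacuously ([dim0_no_height1]), and it remains to compare (1) with (b).

    From (1) to (b), [melkersson_supp] puts every prime p with a prime q strictly below it in the
    support. For x in p outside q and D = R/q, the module X = D[1/x]/D is x-torsion and (0 :_X x) is
    generated by 1/x, so X has a finitely generated submodule with quotient in M. Some x^n kills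
    that submodule, while r x^n / x^(n+1) = 0 in X forces r into xR + q, inside p. Hence the class
    of 1/x^(n+1) in the quotient has its annihilator inside p.

    From (b) to (1), [ex_height1_below], resting on [krull_pit], puts every non-minimal prime in the
    support; by [cyclic_in_supp], Rx is then in M as soon as no minimal prime contains Ann x. Let X
    be I-torsion with (0 :_X I) in S_fg * M, and let T collect the x with Rx in M. Closure under
    injective hulls gives M itself the Melkersson condition ([melkersson_closed_hull]), whence T is
    in M ([serre_torsion_in]). If a product of N primes vanishes in R, [minimal_prime_ann] yields
    that I^N X lies in T. Finally [serre_colon_mod] climbs from L to (L :_X I) inside S_fg * M, and
    N such steps lead from T to X. *)

Definition linear_of (A B : lmodType R) (f : A -> B) (fL : linear f) :
  {linear A -> B} := HB.pack f (GRing.isLinear.Build R A B *:%R f fL).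

(** [Prop]-valued, so that kernels, images and unions of chains are submodules directly;
    [submod_pred] passes to the boolean predicates from which [sub_mod] and [quot_mod] are built. *)
Record submod (V : lmodType R) := Submod {
  submod_mem :> V -> Prop;
  submod_mem0 : submod_mem 0;
  submod_memZD : forall a x y,
    submod_mem x -> submod_mem y -> submod_mem (a *: x + y)
}.

Section Closure.
Variables (V : lmodType R) (N : submod V).

Lemma submodD x y : N x -> N y -> N (x + y).
Proof. by move=> Nx Ny; rewrite -[x]scale1r; exact: submod_memZD. Qed.

Lemma submodZ a x : N x -> N (a *: x).
Proof. by move=> Nx; rewrite -[_ *: _]addr0; apply: submod_memZD => //;
  exact: submod_mem0. Qed.

Lemma submodN x : N x -> N (- x).
Proof. by rewrite -scaleN1r; exact: submodZ. Qed.

Lemma submodB x y : N x -> N y -> N (x - y).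
Proof. by move=> Nx Ny; apply: submodD => //; exact: submodN. Qed.

Definition submod_pred : {pred V} := fun x => `[< N x >].

Lemma submod_predP x : reflect (N x) (x \in submod_pred).
Proof. exact: asboolP. Qed.

Lemma submod_pred_closed : GRing.submod_closed submod_pred.
Proof.
split=> [|a x y /submod_predP Nx /submod_predP Ny]; apply/submod_predP.
  exact: submod_mem0.
exact: submod_memZD.
Qed.

HB.instance Definition _ := GRing.isSubmodClosed.Build R V submod_pred
  submod_pred_closed.

Definition sub_mod := {x : V | x \in submod_pred}.

HB.instance Definition _ := SubChoice.on sub_mod.
HB.instance Definition _ := [SubChoice_isSubLmodule of sub_mod by <:].

Lemma sub_mod_val_linear : linear (val : sub_mod -> V).
Proof. by []. Qed.

Definition sub_val : {linear sub_mod -> V} := linear_of sub_mod_val_linear.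

Lemma sub_val_inj : injective sub_val.
Proof. exact: val_inj. Qed.

Lemma sub_valP (x : sub_mod) : N (sub_val x).
Proof. exact/submod_predP/(valP x). Qed.

Lemma sub_val_ex x : N x -> exists y, sub_val y = x.
Proof. by move=> /submod_predP Nx; exists (exist _ x Nx). Qed.


Definition quot_mod := Quotient.quot (submod_pred : zmodClosed V).

HB.instance Definition _ := GRing.Zmodule.on quot_mod.

Definition quot_pi (x : V) : quot_mod := \pi_(quot_mod)%qT x.

Lemma quot_piP x y : quot_pi x = quot_pi y <-> N (x - y).
Proof.
rewrite /quot_pi; split => [e|Nxy].
  by apply/submod_predP; rewrite Quotient.idealrBE; apply/eqP.
by apply/eqP; rewrite -Quotient.idealrBE; apply/submod_predP.
Qed.

Lemma quot_pi_ex (z : quot_mod) : exists x, quot_pi x = z.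
Proof. by exists (repr z); exact: reprK. Qed.

Lemma quot_piD x y : quot_pi (x + y) = quot_pi x + quot_pi y.
Proof. exact: raddfD. Qed.

Definition quot_scale (a : R) (z : quot_mod) : quot_mod :=
  quot_pi (a *: repr z).

Lemma quot_scaleE a x : quot_scale a (quot_pi x) = quot_pi (a *: x).
Proof.
apply/quot_piP; rewrite -scalerBr; apply: submodZ; apply/quot_piP.
exact: reprK.
Qed.

Lemma quot_scaleA a b z :
  quot_scale a (quot_scale b z) = quot_scale (a * b) z.
Proof. by have [x <-] := quot_pi_ex z; rewrite !quot_scaleE scalerA. Qed.

Lemma quot_scale1 : left_id 1 quot_scale.
Proof. by move=> z; have [x <-] := quot_pi_ex z;
  rewrite quot_scaleE scale1r. Qed.

Lemma quot_scaleDr : right_distributive quot_scale +%R.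
Proof.
move=> a z w; have [x <-] := quot_pi_ex z; have [y <-] := quot_pi_ex w.
by rewrite -quot_piD !quot_scaleE scalerDr quot_piD.
Qed.

Lemma quot_scaleDl z : {morph quot_scale^~ z : a b / a + b}.
Proof.
move=> a b; have [x <-] := quot_pi_ex z.
by rewrite !quot_scaleE scalerDl quot_piD.
Qed.

HB.instance Definition _ := GRing.Zmodule_isLmodule.Build R quot_mod
  quot_scaleA quot_scale1 quot_scaleDr quot_scaleDl.

Lemma quot_pi_linear : linear quot_pi.
Proof. by move=> a x y; rewrite quot_piD -quot_scaleE. Qed.

Definition quot_map : {linear V -> quot_mod} := linear_of quot_pi_linear.

Lemma quot_map_ex (z : quot_mod) : exists x, quot_map x = z.
Proof. exact: quot_pi_ex. Qed.

Lemma quot_map_eq0 x : quot_map x = 0 <-> N x.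
Proof.
rewrite -[0](linear0 quot_map); split => [/quot_piP|Nx]; first by rewrite subr0.
by apply/quot_piP; rewrite subr0.
Qed.

Variables (B : lmodType R) (g : {linear V -> B}) (gN : forall x, N x ->
  g x = 0).

Lemma quot_lift_repr x : g (repr (quot_pi x)) = g x.
Proof.
apply/eqP; rewrite -subr_eq0 -linearB; apply/eqP/gN/quot_piP.
exact: reprK.
Qed.

Lemma quot_lift_linear : linear (fun z : quot_mod => g (repr z)).
Proof.
move=> a z w; have [x <-] := quot_pi_ex z; have [y <-] := quot_pi_ex w.
by rewrite -quot_pi_linear !quot_lift_repr linearP.
Qed.

Definition quot_lift : {linear quot_mod -> B} := linear_of quot_lift_linear.

Lemma quot_liftE x : quot_lift (quot_map x) = g x.
Proof. exact: quot_lift_repr. Qed.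

End Closure.

Section SubLift.
Variables (A B : lmodType R) (N : submod B) (f : {linear A -> B}).
Hypothesis fN : forall x, N (f x).

Definition sub_lift_fun x : sub_mod N :=
  exist _ (f x) (introT (submod_predP N _) (fN x)).

Lemma sub_lift_linear : linear sub_lift_fun.
Proof. by move=> a x y; apply: val_inj; rewrite /= linearP. Qed.

Definition sub_lift : {linear A -> sub_mod N} := linear_of sub_lift_linear.

Lemma sub_liftE x : sub_val N (sub_lift x) = f x.
Proof. by []. Qed.
End SubLift.

Definition sub_incl (V : lmodType R) (N P : submod V)
    (NP : forall x, N x -> P x) : {linear sub_mod N -> sub_mod P} :=
  sub_lift (f := sub_val N) (fun x => NP _ (sub_valP x)).

Definition preim_sub (V W : lmodType R) (f : {linear V -> W}) (N : submod W) :
  submod V.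
Proof.
exists (fun x => N (f x)); first by rewrite linear0; exact: submod_mem0.
by move=> a x y Nx Ny; rewrite linearP; exact: submod_memZD.
Defined.

Definition image_sub (V W : lmodType R) (f : {linear V -> W}) (P : submod V) :
  submod W.
Proof.
exists (fun y => exists2 x, P x & f x = y).
  by exists 0; [exact: submod_mem0|exact: linear0].
move=> a _ _ [x Px <-] [y Py <-].
by exists (a *: x + y); [exact: submod_memZD|rewrite linearP].
Defined.

Definition ker_sub (V W : lmodType R) (f : {linear V -> W}) : submod V.
Proof.
exists (fun x => f x = 0) => [|a x y fx fy]; first exact: linear0.
by rewrite linearP fx fy scaler0 addr0.
Defined.

Definition sub_top (V : lmodType R) : submod V.
Proof. by exists (fun _ => True). Defined.

Definition sub_bot (V : lmodType R) : submod V.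
Proof.
by exists (fun x => x = 0) => // a _ _ -> ->; rewrite scaler0 addr0.
Defined.

Definition adjoin (V : lmodType R) (N : submod V) (e : V) : submod V.
Proof.
exists (fun x => exists r y, N y /\ x = r *: e + y).
  by exists 0, 0; split; [exact: submod_mem0|rewrite scale0r addr0].
move=> a _ _ [r [y [Ny ->]]] [r' [y' [Ny' ->]]].
exists (a * r + r'), (a *: y + y'); split; first exact: submod_memZD.
by rewrite scalerDr scalerDl scalerA addrACA.
Defined.

Lemma adjoin_sub (V : lmodType R) (N : submod V) e x : N x -> adjoin N e x.
Proof. by move=> Nx; exists 0, x; rewrite scale0r add0r. Qed.

Lemma adjoin_mem (V : lmodType R) (N : submod V) e : adjoin N e e.
Proof. by exists 1, 0; rewrite scale1r addr0; split=> //;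
  exact: submod_mem0. Qed.

Definition colon (V : lmodType R) (N : submod V) (e : V) : submod R^o.
Proof.
exists (fun r : R^o => N ((r : R) *: e)).
  by rewrite scale0r; exact: submod_mem0.
move=> a x y Nx Ny; rewrite scalerDl -scalerA.
exact: submod_memZD.
Defined.

Definition lspan (V : lmodType R) (s : seq V) : submod V :=
  foldr (fun e N => adjoin N e) (sub_bot V) s.

Lemma spansE (V : lmodType R) (s : seq V) x : spans s x <-> lspan s x.
Proof.
elim: s x => [|e s IH] x /=.
  split=> [[c ->]|->]; first by rewrite big_ord0.
  by exists (fun _ => 0); rewrite big_ord0.
split=> [[c ->]|[r [y [/IH[c ->] ->]]]].
  rewrite big_ord_recl /=; exists (c 0%N), (\sum_(i < size s) c i.+1 *: s`_i).
  by split=> //; apply/IH; exists (fun i => c i.+1).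
exists (fun i => if i is j.+1 then c j else r).
by rewrite big_ord_recl.
Qed.

Lemma lspan_mem (V : lmodType R) (s : seq V) x : x \in s -> lspan s x.
Proof.
elim: s => //= e s IH; rewrite inE => /orP[/eqP->|/IH xs].
  exact: adjoin_mem.
exact: adjoin_sub.
Qed.

Lemma lspan_min (V : lmodType R) (N : submod V) (s : seq V) :
  (forall x, x \in s -> N x) -> forall x, lspan s x -> N x.
Proof.
elim: s => [_ _ ->|e s IH sN _ [r [y [sy ->]]]]; first exact: submod_mem0.
apply: submod_memZD; first by apply: sN; rewrite mem_head.
by apply: IH sy => x xs; apply: sN; rewrite inE xs orbT.
Qed.

End Submodules.

(** * Noetherian induction *)

Lemma zorn_above (T : Type) (P : set (set T)) (X0 : set T) :
  P X0 ->
  (forall F : set (set T), (F `<=` P)%classic -> total_on F subset ->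
     (F !=set0)%classic -> P (\bigcup_(X in F) X)%classic) ->
  exists2 A, P A & (X0 `<=` A)%classic /\
    forall B, (A `<=` B)%classic -> P B -> (B `<=` A)%classic.
Proof.
move=> PX0 chainP.
(* The empty set joins the family so that the empty chain has its union there; if it turns out to be
   maximal, [X0] itself is the answer. *)
pose Q : set (set T) :=
  [set X | X = set0 \/ P X /\ (X0 `<=` X)%classic]%classic.
have [F FQ totF|A [QA maxA]] := @Zorn_bigcup T Q.
  pose F' := [set X | F X /\ X <> set0]%classic.
  have [F'0|nF'] := pselect (exists X, F' X); last first.
    left; apply/seteqP; split=> // x [X FX Xx]; apply: nF'.
    by exists X; split=> // X0'; rewrite X0' in Xx.
  right; have -> : (\bigcup_(X in F) X = \bigcup_(X in F') X)%classic.
    apply/seteqP; split=> x [X FX Xx].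
      by exists X => //; split=> // X0'; rewrite X0' in Xx.
    by exists X => //; case: FX.
  split.
    apply: chainP => //.
      by move=> X [/FQ[//|[]]].
    by move=> X Y [FX _] [FY _]; exact: totF.
  have [X F'X] := F'0; move=> x X0x; exists X => //.
  by case: F'X => /FQ[//|[_ X0X] _]; exact: X0X.
have QX0 : Q X0 by right; split.
have [A0|An0] := pselect (A = set0).
  exists X0 => //; split=> // B X0B PB x Bx; exfalso.
  apply: (maxA B); last by right; split.
  by rewrite A0; split=> // /(_ x Bx).
case: QA => [//|[PA X0A]]; exists A => //; split=> // B AB PB.
apply: contrapT => nBA; apply: (maxA B) => //.
by right; split=> //; exact: subset_trans AB.
Qed.

Section ChainUnion.
Variables (R : comPzRingType) (V : lmodType R).

Lemma chain_union_submod (F : set (set V)) :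
  (forall X, F X -> exists N : submod V, X = N) -> total_on F subset ->
  (F !=set0)%classic -> exists N : submod V, (\bigcup_(X in F) X)%classic = N.
Proof.
move=> FN totF [X0 FX0].
suff [h0 hD] : (\bigcup_(X in F) X)%classic 0 /\ forall a x y,
    (\bigcup_(X in F) X)%classic x -> (\bigcup_(X in F) X)%classic y ->
    (\bigcup_(X in F) X)%classic (a *: x + y) by exists (Submod h0 hD).
split=> [|a x y [X FX Xx] [Y FY Yy]].
  by exists X0 => //; have [N ->] := FN _ FX0; exact: submod_mem0.
have [XY|YX] := totF _ _ FX FY.
  exists Y => //; have [N eN] := FN _ FY; move/(_ _ Xx) : XY Yy.
  by rewrite eN => Nx Ny; exact: submod_memZD.
exists X => //; have [N eN] := FN _ FX; move/(_ _ Yy) : YX Xx.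
by rewrite eN => Ny Nx; exact: submod_memZD.
Qed.

Lemma chain_union_finite (F : set (set V)) (s : seq V) :
  total_on F subset -> (F !=set0)%classic ->
  (forall x, x \in s -> (\bigcup_(X in F) X)%classic x) ->
  exists2 X, F X & forall x, x \in s -> X x.
Proof.
move=> totF [X0 FX0]; elim: s => [_|e s IH sF]; first by exists X0.
have [x xs|X FX sX] := IH; first by apply: sF; rewrite inE xs orbT.
have [Y FY Ye] : (\bigcup_(X in F) X)%classic e by apply: sF; exact: mem_head.
have [XY|YX] := totF _ _ FX FY.
  by exists Y => // x; rewrite inE => /orP[/eqP-> //|/sX/XY].
by exists X => // x; rewrite inE => /orP[/eqP->|/sX //]; exact: YX.
Qed.
End ChainUnion.

Section Noetherian.
Variable R : comPzRingType.
Notation ideal := (submod R^o).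
Implicit Types I J : ideal.

Lemma idealZ I (a x : R) : I x -> I (a * x).
Proof. exact: (@submodZ R R^o I a x). Qed.

Lemma idealZr I (a x : R) : I x -> I (x * a).
Proof. by rewrite mulrC; exact: idealZ. Qed.

Definition ideal_of (I : {pred R}) (hI : is_ideal I) : ideal.
Proof.
exists (fun x : R^o => is_true ((x : R) \in I)); first by case: hI.
by move=> a x y Ix Iy; case: hI => _; apply.
Defined.

Lemma prime_closed (p : spec R) : is_ideal p. Proof. exact: spec_ideal. Qed.

Definition prime_ideal (p : spec R) : ideal := ideal_of (prime_closed p).

Definition is_prime I :=
  ~ I 1 /\ forall a b : R, I (a * b) -> I a \/ I b.

Lemma spec_of_prime I : is_prime I -> exists p : spec R,
  forall x, x \in spec_val p <-> I x.
Proof.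
move=> [I1 Iab].
have h1 : (1 : R) \notin submod_pred I by apply/submod_predP.
have hm a b : a * b \in submod_pred I ->
  (a \in submod_pred I) || (b \in submod_pred I).
  by move=> /submod_predP/Iab[] /submod_predP ->; rewrite ?orbT.
exists (Spec (submod_pred_closed I) h1 hm) => x /=.
by split=> /submod_predP.
Qed.

Hypothesis R_noeth : noetherian R.

Lemma noeth_span I : exists s : seq R, forall x : R, I x <->
  lspan (V := R^o) s x.
Proof.
have [s sP] := R_noeth (submod_pred_closed I); exists s => x.
by rewrite -spansE -sP; split=> /submod_predP.
Qed.

(** A chain of counterexamples has a finitely generated union, which is therefore a member of the
    chain; Zorn then gives a maximal counterexample, against the induction step. *)
Lemma noeth_ind (Phi : ideal -> Prop) :
  (forall I, (forall J, (forall x, I x -> J x) -> ~ (forall x, J x -> I x) ->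
      Phi J) -> Phi I) ->
  forall I, Phi I.
Proof.
move=> step I0; apply: contrapT => nI0.
pose P : set (set R^o) :=
  [set X : set R^o | exists2 J : ideal, X = J & ~ Phi J]%classic.
have PI0 : P I0 by exists I0.
have [F FP totF F0|A [J AJ nJ] [_ maxA]] := zorn_above PI0; last first.
  apply: nJ; apply: step => K JK nKJ; apply: contrapT => nK.
  by apply: nKJ => x Kx; move: (maxA K); rewrite AJ; apply=> //; exists K.
have [N eN] : exists N : submod R^o, (\bigcup_(X in F) X)%classic = N.
  by apply: chain_union_submod => // X /FP[J ->]; exists J.
have [s sP] := noeth_span N.
have [|X FX sX] := @chain_union_finite R R^o F s totF F0.
  by move=> x xs; rewrite eN; apply/sP; exact: lspan_mem.
suff -> : (\bigcup_(X in F) X)%classic = X by exact: FP.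
apply/seteqP; split=> [x|x Xx]; last by exists X.
have [J eJ _] := FP _ FX; rewrite eN eJ => /sP.
by apply: lspan_min => y /sX; rewrite eJ.
Qed.

Lemma colonE I (a x : R) : colon I a x = I (x * a).
Proof. by []. Qed.

Lemma colon_sub I (a x : R) : I x -> colon I a x.
Proof. by rewrite colonE; exact: idealZr. Qed.

(* A noetherian induction that replaces prime filtrations: it suffices to    *)
(* treat primes and extensions 0 -> R/(I : a) -> R/I -> R/(I + Ra) -> 0.     *)
Lemma ideal_ind (Phi : ideal -> Prop) :
  (forall I, I 1 -> Phi I) ->
  (forall (p : spec R) I, (forall x : R, x \in spec_val p <-> I x) -> Phi I) ->
  (forall I a, Phi (colon I a) -> Phi (adjoin I a) -> Phi I) ->
  forall I, Phi I.
Proof.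
move=> Phi1 Phip PhiE; apply: noeth_ind => I IH.
have [/Phi1//|I1] := pselect (I 1).
have [/spec_of_prime[p pI]|nprime] := pselect (is_prime I);
  first exact: Phip pI.
have [a [b [Iab nIa nIb]]] : exists a b : R, [/\ I (a * b), ~ I a & ~ I b].
  apply: contrapT => nab; apply: nprime; split=> // a b Iab.
  apply: contrapT => /not_orP[nIa nIb].
  by apply: nab; exists a, b.
apply: (PhiE I a); apply: IH.
- by move=> x; exact: colon_sub.
- by move=> /(_ b) h; apply: nIb; apply: h; rewrite colonE mulrC.
- by move=> x; exact: adjoin_sub.
- by move=> /(_ a) h; apply: nIa; apply: h; exact: adjoin_mem.
Qed.

End Noetherian.

(** * Krull's principal ideal theorem and primes of height one *)

Section KrullPIT.
Variables (R : comPzRingType) (R_noeth : noetherian R).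
Notation ideal := (submod R^o).
Implicit Types (I J K : ideal) (p q P Q : spec R).

Lemma spec_mem0 p : 0 \in spec_val p.
Proof. by case: (spec_ideal p). Qed.

Lemma spec_memD p (a b : R) : a \in spec_val p -> b \in spec_val p ->
  a + b \in spec_val p.
Proof. exact: (@submodD R R^o (prime_ideal p) a b). Qed.

Lemma spec_memB p (a b : R) : a \in spec_val p -> b \in spec_val p ->
  a - b \in spec_val p.
Proof. exact: (@submodB R R^o (prime_ideal p) a b). Qed.

Lemma spec_memM p (a b : R) : b \in spec_val p -> a * b \in spec_val p.
Proof. exact: (@idealZ R (prime_ideal p) a b). Qed.

Lemma spec_memMr p (a b : R) : a \in spec_val p -> a * b \in spec_val p.
Proof. by rewrite mulrC; exact: spec_memM. Qed.

Lemma spec_memDr p (a b : R) : b \in spec_val p -> a + b \in spec_val p ->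
  a \in spec_val p.
Proof. by move=> pb pab; rewrite -(addrK b a); exact: spec_memB. Qed.

Lemma spec_memX p (a : R) n : a ^+ n \in spec_val p -> a \in spec_val p.
Proof.
elim: n => [|n IH]; first by rewrite expr0 (negPf (spec_proper p)).
by rewrite exprS => /spec_mem_mul/orP[].
Qed.

Definition minimal_over (P : spec R) (x : R) :=
  x \in spec_val P /\ forall p, x \in spec_val p -> {subset p <= P} ->
    {subset P <= p}.

(* R_P/xR_P has a single prime, hence is artinian; localization at P is       *)
(* expressed by multipliers s outside P.                                      *)
Lemma local_dcc P x (J : nat -> ideal) :
  minimal_over P x -> (forall n (y : R), J n.+1 y -> J n y) ->
  forall I, I x -> exists n0, forall n, (n0 <= n)%N -> forall y : R, J n0 y ->
    exists2 s : R, s \notin spec_val P &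
      exists j i : R, [/\ J n j, I i & s * y = j + i].
Proof.
move=> [Px minP] Jdec I Ix; move: J Jdec.
have Jle (J : nat -> ideal) : (forall n (y : R), J n.+1 y -> J n y) ->
    forall m n, (m <= n)%N -> forall y : R, J n y -> J m y.
  move=> Jdec m n /subnK <-; elim: (n - m)%N => // k IH y.
  by rewrite addSn => /Jdec/IH.
elim/(ideal_ind R_noeth): I Ix => [I I1 _|p I pI Ix|I a IH1 IH2 Ix] J Jdec.
- exists 0%N => n _ y _; exists 1; first exact: spec_proper.
  exists 0, (1 * y); split; rewrite ?add0r //; first exact: submod_mem0.
  by apply: idealZr.
(* Locally at P, a prime not contained in P is the unit ideal; one inside P contains x, hence equals
   P, and modulo P each [J n] is zero or everything. *)
- have [pP|/existsNP[s /not_implyP[ps /negP sP]]] := pselect {subset p <= P};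
  last first.
    exists 0%N => n _ y _; exists s => //.
    exists 0, (s * y); split; rewrite ?add0r //; first exact: submod_mem0.
    by apply/pI; exact: spec_memMr.
  have Pp : {subset P <= p} by apply: minP => //; apply/pI.
  have [[n0 n0P]|nJ] :=
    pselect (exists n0, forall y : R, J n0 y -> y \in spec_val P).
    exists n0 => n _ y /n0P/Pp/pI Iy; exists 1; first exact: spec_proper.
    by exists 0, y; split; rewrite ?add0r ?mul1r //; exact: submod_mem0.
  exists 0%N => n _ y _.
  have [s [Js sP]] : exists s : R, J n s /\ s \notin spec_val P.
    apply: contrapT => ns; apply: nJ; exists n => s Js.
    by apply: contrapT => /negP sP; apply: ns; exists s.
  exists s => //; exists (s * y), 0; split; rewrite ?addr0 //.
    exact: idealZr.
  exact: submod_mem0.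
have [n2 n2P] := IH2 (adjoin_sub _ Ix) J Jdec.
(* L n = (J n + I : a) *)
have hL n : exists L : ideal, forall r : R, L r <->
  exists j i : R, [/\ J n j, I i & r * a = j + i].
  have h0 : exists j i : R, [/\ J n j, I i & 0 * a = j + i].
    by exists 0, 0; split; rewrite ?mul0r ?addr0 //; exact: submod_mem0.
  have hD (c : R) (u v : R^o) :
    (exists j i : R, [/\ J n j, I i & u * a = j + i]) ->
     (exists j i : R, [/\ J n j, I i & v * a = j + i]) ->
     exists j i : R, [/\ J n j, I i & (c *: u + v) * a = j + i].
    move=> [j [i [Jj Ii e]]] [j' [i' [Jj' Ii' e']]].
    exists (c * j + j'), (c * i + i'); split; try exact: submod_memZD.
    have -> : (c *: u + v) * a = c * (u * a) + v * a by rewrite /GRing.scale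
      /=; ring.
    by rewrite e e'; ring.
  by exists (@Submod R R^o _ h0 hD).
have [L LP] := choice hL.
have Ldec n (r : R) : L n.+1 r -> L n r.
  by move=> /LP[j [i [Jj Ii e]]]; apply/LP; exists j, i; split=> //;
    exact: Jdec.
have [n1 n1P] := IH1 (colon_sub _ Ix) L Ldec.
exists (maxn n1 n2) => n nn y Jy.
have [|s sP [j [i [Jj [r [i' [Ii' ->]]] e]]]] :=
  n2P n _ y (Jle _ Jdec _ _ (leq_maxr _ _) _ Jy).
  by apply: leq_trans nn; exact: leq_maxr.
(* The coefficient r of [a] lies in [L n1], hence up to a multiplier in [L n] + (I : a), which moves
   r a into [J n] + I. *)
have Lr : L n1 r.
  apply/LP; exists (s * y - j), (- i'); split.
  - apply: submodB; first by apply: idealZ;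
    apply: (Jle _ Jdec _ _ (leq_maxl _ _)) Jy.
    by apply: (Jle _ Jdec n1 n) Jj; apply: leq_trans nn; exact: leq_maxl.
  - exact: submodN.
  - by rewrite e /GRing.scale /=; ring.
have [|s' s'P [r1 [r2 [/LP[j' [i2 [Jj' Ii2 e']]] Ir2 e2]]]] := n1P n _ r Lr.
  by apply: leq_trans nn; exact: leq_maxl.
exists (s' * s); first exact: spec_complM.
exists (s' * j + j'), (i2 + r2 * a + s' * i'); split.
- by apply: submodD => //; exact: idealZ.
- by apply: submodD; [apply: submodD|exact: idealZ].
- rewrite -mulrA e /GRing.scale /= !mulrDr mulrA e2 mulrDl e'; ring.
Qed.

(** Nakayama's lemma for J = K + xJ at P, removing generators one at a time: substituting the
    expression of j by generators into s e = k + x j gives a relation with coefficient s' s - x r at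
    e, which is outside P because x is in P. *)
Lemma local_nakayama P (x : R) J (g : seq R^o) : x \in spec_val P ->
  forall K, (forall e, e \in g -> J e) ->
  (forall y : R, J y -> exists2 s : R, s \notin spec_val P &
      foldr (fun e N => adjoin N e) K g (s * y)) ->
  (forall y : R, J y -> exists2 s : R, s \notin spec_val P &
      exists k j : R, [/\ K k, J j & s * y = k + x * j]) ->
  forall y : R, J y -> exists2 s : R, s \notin spec_val P & K (s * y).
Proof.
move=> Px; elim: g => [//|e g IH] K gJ /= Jg JK; apply: IH => // [z zg|y Jy].
  by apply: gJ; rewrite inE zg orbT.
set K' := foldr _ _ _ in Jg *.
have KK' (z : R) : K z -> K' z.
  rewrite /K'; elim: (g) => //= e' g' IHg Kz; apply: adjoin_sub; exact: IHg.
have Je : J e by apply: gJ; exact: mem_head.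
have [s sP [k [j [Kk Jj es]]]] := JK _ Je.
have [s' s'P [r [w [K'w es']]]] := Jg _ Jj.
have [t tP [r' [w' [K'w' et]]]] := Jg _ Jy.
exists ((s' * s - x * r) * t).
  apply: spec_complM => //; apply: contra (spec_complM s'P sP) => h.
  by apply: (@spec_memDr _ _ (- (x * r))) => //; rewrite -mulrN;
    exact: spec_memMr.
have -> : (s' * s - x * r) * t * y = r' * (s' * k + x * w) + (s' * s - x * r) *
  w'.
  rewrite -mulrA et /GRing.scale /=.
  have -> : s' * k + x * w = s' * (k + x * j) - x * (s' * j) + x * w by ring.
  rewrite -es es' /GRing.scale /=; ring.
apply: submodD; last exact: idealZ.
apply: idealZ; apply: submodD; apply: idealZ => //; exact: KK'.
Qed.

(** With y in Q outside Q0, the ideals [J n] defined below decrease, and become stationary modulo x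
    by [local_dcc]. As x is not in Q, it can be divided out, so J n0 = J (n0+1) + x J n0 at P, and
    Nakayama gives J n0 = J (n0+1) at P. Then y^n0 (s' s - t y) is in Q0 with s' s outside Q, which
    is impossible. *)
Lemma krull_pit P x Q0 Q : minimal_over P x ->
  strict_sub Q0 Q -> strict_sub Q P -> False.
Proof.
move=> minP [Q0Q nQ0] [QP nQ].
have [y /not_implyP[Qy /negP Q0y]] :
  exists y, ~ (y \in spec_val Q -> y \in spec_val Q0).
  exact/existsNP.
have [Px minx] := minP.
have Qx : x \notin spec_val Q by apply/negP => /minx/(_ QP).
(* The preimage in R of y^n R_Q + Q0 R_Q, in the role of a symbolic power. *)
pose mJ n (a : R^o) :=
  exists s b t : R, [/\ s \notin spec_val Q, b \in spec_val Q0 &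
    s * a = t * y ^+ n + b].
have mJ0 n : mJ n 0.
  exists 1, 0, 0; split;
    [exact: spec_proper|exact: spec_mem0|by rewrite mulr0 mul0r addr0].
have mJD n (c : R) (u v : R^o) : mJ n u -> mJ n v -> mJ n (c *: u + v).
  move=> [s [b [t [sQ bQ e]]]] [s' [b' [t' [sQ' bQ' e']]]].
  exists (s * s'), (s' * c * b + s * b'), (s' * c * t + s * t'); split.
  - exact: spec_complM.
  - by apply: spec_memD; exact: spec_memM.
  - have -> : s * s' * (c *: u + v) = s' * c * (s * u) + s * (s' * v).
      rewrite /GRing.scale /=; ring.
    by rewrite e e'; ring.
pose J n : ideal := Submod (mJ0 n) (@mJD n).
have Jdec n (z : R) : J n.+1 z -> J n z.
  move=> [s [b [t [sQ bQ e]]]]; exists s, b, (t * y); split=> //.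
  by rewrite e exprS mulrA.
have [n0 n0P] := local_dcc minP Jdec (adjoin_mem (sub_bot R^o) x).
have key (z : R) : J n0 z -> exists2 s : R, s \notin spec_val P &
    exists k j : R, [/\ J n0.+1 k, J n0 j & s * z = k + x * j].
  move=> Jz; have [s sP [k [_ [Jk [r [_ [-> ->]]] e]]]] :=
    n0P _ (leqnSn n0) _ Jz.
  exists s => //; exists k, r; split=> //;
    last by rewrite e /GRing.scale /= addr0 [r * x]mulrC.
  have [s1 [b [t [s1Q Q0b e1]]]] : J n0 (x * r : R).
    have -> : x * r = s * z - k by rewrite e /GRing.scale /=; ring.
    by apply: submodB; [exact: idealZ|exact: Jdec].
  exists (s1 * x), b, t; split; [exact: spec_complM|by []|by rewrite -mulrA].
have [g gP] := noeth_span R_noeth (J n0).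
have Jyn : J n0 (y ^+ n0).
  exists 1, 0, 1; split;
    [exact: spec_proper|exact: spec_mem0|by rewrite !mul1r addr0].
have [||s sP [s' [b [t [s'Q Q0b e]]]]] :=
  local_nakayama Px (g := g) (K := J n0.+1) _ _ key Jyn.
- by move=> z zg; apply/gP; exact: lspan_mem.
- move=> z /gP Jz; exists 1; first exact: spec_proper.
  rewrite mul1r; apply: lspan_min Jz => w; elim: (g) => //= e g' IHg.
  rewrite inE => /orP[/eqP->|/IHg]; first exact: adjoin_mem.
  exact: adjoin_sub.
have sQ : s \notin spec_val Q by apply: contra sP => /QP.
have : y ^+ n0 * (s' * s - t * y) \in spec_val Q0.
  have -> // : y ^+ n0 * (s' * s - t * y) = b.
  by rewrite mulrBr [_ * (s' * s)]mulrC -mulrA e exprS; ring.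
move=> /spec_mem_mul/orP[/spec_memX|/Q0Q h]; first exact/negP.
have /negP := spec_complM s'Q sQ; apply.
by apply: (@spec_memDr _ _ (- (t * y))) => //; rewrite -mulNr; exact: spec_memM.
Qed.

End KrullPIT.

(** * Products of primes, minimal primes and height *)

Section Primes.
Variables (R : comPzRingType) (R_noeth : noetherian R).
Notation ideal := (submod R^o).
Implicit Types (I J K : ideal) (p q P Q : spec R) (l : seq (spec R)).

Definition quotient_ideal I (A : R -> Prop) : ideal.
Proof.
exists (fun u : R^o => forall v : R, A v ->
  I ((u : R) * v)) => [v _|a x y Ix Iy v Av].
  by rewrite mul0r; exact: submod_mem0.
have -> : (a *: x + y) * v = a * (x * v) + y * v by rewrite /GRing.scale /=;
  ring.
by apply: submodD; [apply: idealZ; exact: Ix|exact: Iy].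
Defined.

(* I contains the product of the primes in l, unfolded one factor at a time. *)
Fixpoint contains_prod l I : Prop :=
  if l is p :: l' then
    forall c : R, c \in spec_val p -> contains_prod l' (colon I c)
  else I 1.

Lemma contains_prod_sub l I J : (forall x : R, I x -> J x) ->
  contains_prod l I -> contains_prod l J.
Proof.
elim: l I J => [|p l IH] I J IJ /=; first exact: IJ.
by move=> lI c pc; apply: IH (lI c pc) => x; rewrite !colonE; exact: IJ.
Qed.

Lemma contains_prod_cat l1 l2 I J :
  contains_prod l1 (quotient_ideal I J) -> contains_prod l2 J ->
  contains_prod (l1 ++ l2) I.
Proof.
move=> + l2J; elim: l1 I => [|p l IH] I /= => [IJ|lI c pc].
  by apply: contains_prod_sub l2J => x /IJ; rewrite mul1r.
apply: IH; apply: contains_prod_sub (lI c pc) => x; rewrite colonE => h v Jv.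
by rewrite colonE mulrAC; exact: h.
Qed.

Lemma contains_prod_quotient l I (A : R -> Prop) :
  (forall c, A c -> contains_prod l (colon I c)) ->
  contains_prod l (quotient_ideal I A).
Proof.
elim: l I => [|p l IH] I /= lI; first by move=> c /lI.
move=> d pd; apply: (@contains_prod_sub _ (quotient_ideal (colon I d) A)).
  by move=> x h v /h; rewrite colonE mulrAC.
apply: IH => c Ac; apply: contains_prod_sub (lI c Ac d pd) => x.
by rewrite !colonE mulrAC.
Qed.

(** Since (I : a)(I + Ra) is contained in I, the lists found for the two larger ideals concatenate
    to one for I. *)
Lemma ex_primes_prod I : exists2 l, contains_prod l I &
  forall p, List.In p l -> forall x : R, I x -> x \in spec_val p.
Proof.
elim/(ideal_ind R_noeth): I => [I I1|p I pI|I a [l1 l1I l1P] [l2 l2I l2P]].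
- by exists [::].
- exists [:: p] => [c /pI Ic|p']; first by rewrite /= /GRing.scale /= mul1r.
  by case=> // <- x /pI.
- exists (l1 ++ l2) => [|p]; last first.
    rewrite List.in_app_iff => -[pl|pl] x Ix; first by apply: l1P pl _ _;
      exact: colon_sub.
    by apply: l2P pl _ _; exact: adjoin_sub.
  apply: contains_prod_cat l2I; apply: contains_prod_sub l1I => x.
  rewrite colonE => Ixa _ [r [i [Ii ->]]].
  have -> : x * (r *: (a : R^o) + i) = r * (x * a) + x * i by rewrite
    /GRing.scale /=; ring.
  by apply: submodD; exact: idealZ.
Qed.

Lemma contains_prod_prime l I q : contains_prod l I ->
  (forall x : R, I x -> x \in spec_val q) -> exists2 p, List.In p l &
    {subset p <= q}.
Proof.
elim: l I => [|p l IH] I /= lI Iq.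
  by have /negP := spec_proper q; case; exact: Iq.
have [pq|/existsNP[c /not_implyP[pc /negP qc]]] := pselect {subset p <= q}.
  by exists p => //; left.
have [x|p' p'l p'q] := IH _ (lI c pc).
  by rewrite colonE => /Iq/spec_mem_mul/orP[//|]; rewrite (negPf qc).
by exists p' => //; right.
Qed.

Definition minimal_prime p := forall q, {subset q <= p} -> {subset p <= q}.


Lemma count_lt (T : Type) (a b : pred T) (x : T) (s : seq T) :
  subpred a b -> List.In x s -> b x -> ~~ a x -> (count a s < count b s)%N.
Proof.
move=> ab + bx ax; elim: s => //= y s IH [->|/IH h].
  by rewrite bx (negPf ax) add0n add1n ltnS; exact: sub_count.
rewrite -addnS; apply: leq_add h.
by case: (boolP (a y)) => // /ab ->.
Qed.

(** Descent on the number of members of the list inside p, which drops by [count_lt] when p is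
    replaced by a strictly smaller member. *)
Lemma ex_minimal_in l p : List.In p l -> exists2 P, List.In P l &
  {subset P <= p} /\
  forall q, List.In q l -> {subset q <= P} -> {subset P <= q}.
Proof.
have [n] := ubnP (count (fun q => `[< {subset q <= p} >]) l).
elim: n p => // n IH p; rewrite ltnS => cn pl.
have [minp|/existsNP[q /not_implyP[ql /not_implyP[qp pq]]]] :=
    pselect (forall q, List.In q l -> {subset q <= p} -> {subset p <= q}).
  by exists p => //; split.
have [|//|P Pl [Pq minP]] := IH q; last first.
  by exists P => //; split=> // x /Pq/qp.
apply: leq_trans cn; apply: (count_lt (x := p)) => //.
- by move=> q' /asboolP h; apply/asboolP => x /h/qp.
- exact/asboolP.
- exact/asboolP.
Qed.

(** Every prime containing x contains a factor of some product of primes lying in Rx, so a factor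
    minimal in that list is minimal over x. *)
Lemma ex_minimal_over q (x : R) : x \in spec_val q ->
  exists2 P, minimal_over P x & {subset P <= q}.
Proof.
move=> qx; have [l lI lP] := ex_primes_prod (adjoin (sub_bot R^o) x).
have Ip p : x \in spec_val p -> forall y : R, adjoin (sub_bot R^o) x y ->
  y \in spec_val p.
  by move=> px _ [r [_ [-> ->]]]; rewrite addr0; exact: spec_memM.
have [p pl pq] := contains_prod_prime lI (Ip _ qx).
have [P Pl [Pp minP]] := ex_minimal_in pl.
exists P => [|y /Pp/pq //]; split; first by apply: (lP _ Pl); exact: adjoin_mem.
move=> p' p'x p'P; have [p'' p''l p''p'] := contains_prod_prime lI (Ip _ p'x).
by move=> y /(minP _ p''l (fun z hz => p'P _ (p''p' _ hz)))/p''p'.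
Qed.

(** If the x found for the tail falls into the new prime p, it is corrected to x + c y, with y in P
    outside p and c outside p but in all primes of the tail. *)
Lemma minimal_prime_avoidance l P : (forall p, List.In p l ->
  minimal_prime p) ->
  (forall p, List.In p l -> ~ {subset P <= p}) ->
  exists2 x : R, x \in spec_val P & forall p, List.In p l ->
    x \notin spec_val p.
Proof.
elim: l => [|p l IH] minl nP; first by exists 0 => //; exact: spec_mem0.
have [||x Px xl] := IH; [by move=> q ql; apply: minl; right
  |by move=> q ql; apply: nP; right|].
have minp : minimal_prime p by apply: minl; left.
have [px|npx] := boolP (x \in spec_val p); last first.
  by exists x => // q [<- //|/xl].
have [y /not_implyP[Py /negP py]] :
  exists y, ~ (y \in spec_val P -> y \in spec_val p).
  by apply/existsNP; apply: nP; left.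
have [c pc cl] : exists2 c : R, c \notin spec_val p & forall q, List.In q l ->
  c \in spec_val q.
  (* A prime of the tail inside p would equal p by minimality and contain x. *)
  have lp q : List.In q l -> ~ {subset q <= p}.
    by move=> ql /minp/(_ x px); apply/negP; exact: xl.
  elim: (l) lp => [|q l' IHl] lp; first by exists 1; first exact: spec_proper.
  have [|c pc cl] := IHl; first by move=> q' ql; apply: lp; right.
  have [d /not_implyP[qd /negP pd]] :
    exists d, ~ (d \in spec_val q -> d \in spec_val p).
    by apply/existsNP; apply: lp; left.
  exists (d * c) => [|q' [<-|/cl]];
    [exact: spec_complM|exact: spec_memMr|exact: spec_memM].
exists (x + c * y) => [|q [<-|ql]].
- by apply: spec_memD => //; exact: spec_memM.
- apply: contra (spec_complM pc py) => h; apply: (@spec_memDr _ _ _ x) => //.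
  by rewrite addrC.
- apply: contra (xl _ ql) => h; apply: spec_memDr h.
by apply: spec_memMr; exact: cl.
Qed.

(** [supremum] selects some least upper bound, with default -oo; uniqueness of least upper bounds
    identifies the selected value. *)
Lemma sup_nat_max (A : set nat) m : A m -> (forall n, A n -> (n <= m)%N) ->
  sup_nat A = m%:Z%:E.
Proof.
move=> Am maxA; rewrite /sup_nat /supremum; case: ifPn => [/eqP A0|_].
  by have : set0 (m%:Z%:E : \bar int) by rewrite -A0; exists m.
have lub : supremums [set (n%:Z)%:E | n in A]%classic (m%:Z%:E : \bar int).
  split=> [_ [n An <-]|y]; first by rewrite lee_fin lez_nat maxA.
  by apply; exists m.
by case: xgetP => [y _ /is_subset1_supremums|/(_ _ lub) //]; apply.
Qed.

Lemma sup_nat_le (A : set nat) (m n : nat) : sup_nat A = n%:Z%:E -> A m ->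
  (m <= n)%N.
Proof.
rewrite /sup_nat /supremum; case: ifPn => // _.
case: xgetP => [y -> [ub _] yE Am|//].
have /ub : [set (k%:Z)%:E | k in A]%classic (m%:Z%:E : \bar int) by exists m.
by rewrite yE lee_fin lez_nat.
Qed.

Lemma height_eq1 P : (exists q, strict_sub q P) ->
  (forall Q0 Q, strict_sub Q0 Q -> ~ strict_sub Q P) -> height P = 1%:E.
Proof.
move=> [q qP] noch; apply: (@sup_nat_max _ 1).
  by exists (fun n => if n is 0%N then q else P) => // -[|].
move=> [|[|n]] // [c chc cn].
case: (noch (c n) (c n.+1)); first by apply: chc.
by rewrite -cn; exact: chc.
Qed.

Lemma height1_strict P : height P = 1%:E -> exists q, strict_sub q P.
Proof.
move=> h1; apply: contrapT => nq.
suff : height P = 0%:E by rewrite h1.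
apply: (@sup_nat_max _ 0); first by exists (fun=> P).
move=> [|n] // [c chc cn]; case: nq; exists (c n); rewrite -cn; exact: chc.
Qed.

Lemma dim0_no_height1 : krull_dim R = 0%:E -> forall P, height P <> 1%:E.
Proof.
move=> d0 P /height1_strict[q qP].
suff : (1 <= 0)%N by [].
apply: (@sup_nat_le _ 1 0 d0); exists (fun n => if n is 0%N then q else P).
by move=> [|].
Qed.

Lemma not_minimal_strict p : ~ minimal_prime p -> exists q, strict_sub q p.
Proof. by move=> /existsNP[q /not_implyP[qp nqp]]; exists q. Qed.

(** By avoidance, p contains an x outside all minimal primes that occur in a product of primes equal
    to zero, and every minimal prime is one of these up to equality. A prime P inside p and minimal
    over x is then not minimal, while [krull_pit] excludes chains of length 2 ending at P. *)
Lemma ex_height1_below p : ~ minimal_prime p ->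
  exists2 P, height P = 1%:E & {subset P <= p}.
Proof.
move=> nminp; have [l lI lP] := ex_primes_prod (sub_bot R^o).
have [||x px xl] := @minimal_prime_avoidance
  (List.filter (fun q => `[< minimal_prime q >]) l) p.
- by move=> q /List.filter_In[_ /asboolP].
- move=> q /List.filter_In[_ /asboolP minq] pq; apply: nminp => q' q'p y py.
  by apply: (minq q') => [z /q'p/pq //|]; exact: pq.
have [P minP Pp] := ex_minimal_over px; exists P => //.
apply: height_eq1 => [|Q0 Q Q0Q QP];
  last exact: (krull_pit R_noeth minP Q0Q QP).
apply: not_minimal_strict => minimalP.
have [q ql qP] : exists2 q, List.In q l & {subset q <= P}.
  by apply: contains_prod_prime lI _ => _ ->; exact: spec_mem0.
have minq : minimal_prime q.
  move=> q' q'q z qz; apply: (minimalP q'); last exact: qP.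
  by move=> w /q'q/qP.
have /negP := xl q (proj2 (List.filter_In _ _ _)
  (conj ql (introT (asboolP _) minq))); apply.
by apply: (minimalP q) => //; case: minP.
Qed.

(** A factor p inside q equals q, so it contains I and absorbs one factor from the power of I; a
    factor not inside q contributes an element outside q to the multiplier s. *)
Lemma minimal_prime_ann q l (I : {pred R}) J : {subset I <= q} ->
  (forall p, {subset p <= q} -> {subset q <= p}) -> contains_prod l J ->
  exists2 s : R, s \notin spec_val q &
    forall b, b \in ideal_exp I (size l) -> J (s * b).
Proof.
move=> Iq minq; elim: l J => [|p l IH] J lJ.
  by exists 1 => [|b _];
    [exact: spec_proper|rewrite mul1r -[b]mulr1; exact: idealZ].
have sumJ (s : R) : (forall u1 u2 : R, u1 \in I ->
  u2 \in ideal_exp I (size l) -> J (s * (u1 * u2))) ->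
    forall b, b \in ideal_exp I (size l).+1 -> J (s * b).
  move=> h b /asboolP[t tI ->]; elim: t tI => [|u t IHt] /=.
    by rewrite big_nil mulr0 => _; exact: submod_mem0.
  move=> /andP[/andP[u1 u2] tI]; rewrite big_cons mulrDr.
  by apply: submodD; [exact: h|exact: IHt].
have [pq|/existsNP[c /not_implyP[pc /negP qc]]] := pselect {subset p <= q}.
  have [s sq sJ] := IH (quotient_ideal J (fun c =>
    c \in spec_val p)) (contains_prod_quotient lJ).
  exists s => //; apply: sumJ => u1 u2 Iu1 /sJ h.
  have -> : s * (u1 * u2) = s * u2 * u1 by ring.
  by apply: h; apply: (minq p) => //; exact: Iq.
have [s sq sJ] := IH _ (lJ c pc).
exists (s * c); first exact: spec_complM.
apply: sumJ => u1 u2 _ /sJ; rewrite colonE => h.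
have -> : s * c * (u1 * u2) = u1 * (s * u2 * c) by ring.
exact: idealZ.
Qed.

End Primes.

(** * Serre subcategories *)

Section SerreTheory.
Variables (R : comPzRingType) (M : lmodType R -> Prop) (M_serre : serre M).

(** B is an extension of the image of g, a submodule of C, by ker g, a quotient of the submodule
    f^-1(ker g) of A. *)
Lemma serre_mid (A B C : lmodType R) (f : {linear A -> B}) (g : {linear B ->
  C}) :
  (forall y, g y = 0 -> exists x, f x = y) -> M A -> M C -> M B.
Proof.
move=> exact_fg MA MC.
pose K := ker_sub g; pose A' := preim_sub f K.
have fK (x : sub_mod A') : K ((f \o sub_val A') x) by exact: (sub_valP x).
have MK : M (sub_mod K).
  apply: (serre_quot M_serre (g := sub_lift fK)).
    move=> y; have [x fx] := exact_fg _ (sub_valP y).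
    have /sub_val_ex[x' x'x] : A' x by rewrite /= fx; exact: (sub_valP y).
    by exists x'; apply: (@sub_val_inj _ _ K); rewrite sub_liftE -fx -x'x.
  exact: (serre_sub M_serre (@sub_val_inj _ _ A')).
have gI x : image_sub g (sub_top B) (g x) by exists x.
have MI : M (sub_mod (image_sub g (sub_top B))).
  exact: (serre_sub M_serre (@sub_val_inj _ _ _)).
apply: (serre_ext M_serre (f := sub_val K) (g := sub_lift gI)) MK MI; split.
- exact: sub_val_inj.
- move=> y; split=> [gy|[x <-]].
    apply: sub_val_ex; rewrite /= -(sub_liftE gI y) gy; exact: linear0.
  by apply: (@sub_val_inj _ _ (image_sub g (sub_top B)));
    rewrite sub_liftE linear0; exact: (sub_valP x).
- move=> z; have [x _ xz] := sub_valP z; exists x.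
  by apply: (@sub_val_inj _ _ (image_sub g (sub_top B))); rewrite sub_liftE.
Qed.

(** X/N is a quotient of X/ker g, which embeds in B. *)
Lemma serre_quot_mod (X B : lmodType R) (g : {linear X -> B}) (N : submod X) :
  (forall x, g x = 0 -> N x) -> M B -> M (quot_mod N).
Proof.
move=> gN MB; pose K := ker_sub g.
have gK x : K x -> g x = 0 by [].
have MK : M (quot_mod K).
  apply: (serre_sub M_serre (f := quot_lift gK)) MB => z w.
  have [x <-] := quot_map_ex z; have [y <-] := quot_map_ex w.
  rewrite !quot_liftE => e; apply/quot_piP => /=.
  by rewrite linearB e subrr.
have KN x : K x -> quot_map N x = 0 by move=> /gN Nx; exact/quot_map_eq0.
apply: (serre_quot M_serre (g := quot_lift KN)) MK => z.
by have [x <-] := quot_map_ex z; exists (quot_map K x); rewrite quot_liftE.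
Qed.

Lemma serre_sub_mod (X : lmodType R) (N P : submod X) :
  (forall x, N x -> P x) -> M (sub_mod P) -> M (sub_mod N).
Proof.
move=> NP; apply: (serre_sub M_serre (f := sub_incl NP)) => x y e.
by apply: (@sub_val_inj _ _ N);
  rewrite -(sub_liftE (fun x => NP _ (sub_valP x)) x)
    -[RHS](sub_liftE (fun x => NP _ (sub_valP x)) y) -/(sub_incl NP) e.
Qed.

Lemma pair_linear (A B : lmodType R) : linear (fun x : A => (x, 0) : A * B).
Proof.
move=> a x y.
rewrite -[RHS]/(a *: x + y, a *: (0 : B) + 0).
by rewrite scaler0 addr0.
Qed.

Lemma serre_prod (A B : lmodType R) : M A -> M B -> M (A * B)%type.
Proof.
move=> MA MB.
apply: (serre_mid (f := linear_of (@pair_linear A B)) (g := @snd A B)) MA MB.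
by move=> [x y] /= ->; exists x.
Qed.

Lemma serre_sub_bot (X : lmodType R) : M (sub_mod (sub_bot X)).
Proof.
have [B MB] := serre_nonempty M_serre.
apply: (serre_sub M_serre (f := \0 : {linear sub_mod (sub_bot X) -> B})) MB =>
  x y _.
by apply: (@sub_val_inj _ _ (sub_bot X)); rewrite (sub_valP x) (sub_valP y).
Qed.

(** For a Serre subcategory M this says that Rx is in M, as Rx is then a quotient of Ry. Comparing
    annihilators makes it easy to pass between modules. *)
Definition cyclic_in (X : lmodType R) (x : X) : Prop :=
  exists2 B, M B & exists y : B, forall r, r *: y = 0 -> r *: x = 0.

Lemma scale_linear (X : lmodType R) (x : X) :
  linear (fun r : R^o => (r : R) *: x).
Proof. by move=> a r s; rewrite scalerDl -scalerA. Qed.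

Lemma cyclic_in_quot (X : lmodType R) (x : X) :
  cyclic_in x -> M (quot_mod (ker_sub (linear_of (scale_linear x)))).
Proof.
move=> [B MB [y yx]].
by apply: (serre_quot_mod (g := linear_of (scale_linear y))) MB => r /yx.
Qed.

Lemma cyclic_in_span (X : lmodType R) (x : X) :
  cyclic_in x -> M (sub_mod (lspan [:: x])).
Proof.
move=> /cyclic_in_quot MQ.
have h r : lspan [:: x] (linear_of (scale_linear x) r).
  by exists r, 0; rewrite addr0.
have hK r : ker_sub (linear_of (scale_linear x)) r -> sub_lift h r = 0.
  by move=> rx; apply: (@sub_val_inj _ _ (lspan [:: x]));
    rewrite sub_liftE linear0.
apply: (serre_quot M_serre (g := quot_lift hK)) MQ => z.
have [r [_ [-> e]]] := sub_valP z.
exists (quot_map _ (r : R^o)); rewrite quot_liftE.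
by apply: (@sub_val_inj _ _ (lspan [:: x])); rewrite sub_liftE e addr0.
Qed.

Lemma serre_adjoin (X : lmodType R) (N : submod X) x :
  M (sub_mod N) -> cyclic_in x -> M (sub_mod (adjoin N x)).
Proof.
move=> MN /cyclic_in_span Mx.
have addL : linear (fun u : sub_mod (lspan [:: x]) * sub_mod N =>
    sub_val _ u.1 + sub_val _ u.2).
  move=> a u v; rewrite -[(a *: u + v).1]/(a *: u.1 + v.1).
  by rewrite -[(a *: u + v).2]/(a *: u.2 + v.2) !linearP scalerDr addrACA.
have addP u : adjoin N x (linear_of addL u).
  have [r [_ [-> e]]] := sub_valP u.1; exists r, (sub_val _ u.2).
  split; first exact: sub_valP.
  by rewrite -[LHS]/(sub_val (lspan [:: x]) u.1 + sub_val N u.2) e addr0.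
apply: (serre_quot M_serre (g := sub_lift addP)) (serre_prod Mx MN) => z.
have [r [y [Ny e]]] := sub_valP z.
have [y' y'y] := sub_val_ex Ny.
have [x' x'x] : exists x', sub_val (lspan [:: x]) x' = r *: x.
  by apply: sub_val_ex; exists r, 0; rewrite addr0.
exists (x', y'); apply: (@sub_val_inj _ _ (adjoin N x)).
by rewrite sub_liftE e -y'y -x'x.
Qed.

Lemma serre_lspan (X : lmodType R) (s : seq X) :
  (forall x, x \in s -> cyclic_in x) -> M (sub_mod (lspan s)).
Proof.
elim: s => [_|x s IH sM]; first exact: serre_sub_bot.
apply: serre_adjoin; last by apply: sM; exact: mem_head.
by apply: IH => y ys; apply: sM; rewrite inE ys orbT.
Qed.

Lemma cyclic_in_mem (X : lmodType R) (N : submod X) x :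
  M (sub_mod N) -> N x -> cyclic_in x.
Proof.
move=> MN /sub_val_ex[y <-]; exists (sub_mod N) => //; exists y => r ry.
by rewrite -linearZ ry linear0.
Qed.

(** The union of all submodules of X lying in M; it is closed under sums because two of its elements
    span a submodule in M. *)
Definition serre_torsion (X : lmodType R) : submod X.
Proof.
exists (@cyclic_in X) => [|a x y Tx Ty].
  have [B MB] := serre_nonempty M_serre; exists B => //.
  by exists 0 => r _; rewrite scaler0.
apply: (@cyclic_in_mem _ (lspan [:: x; y])).
  by apply: serre_lspan => z; rewrite !inE => /orP[] /eqP->.
by apply: submod_memZD; apply: lspan_mem; rewrite !inE eqxx ?orbT.
Defined.

Lemma serre_torsionE (X : lmodType R) (x : X) :
  serre_torsion X x <-> cyclic_in x.
Proof. by []. Qed.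

(** A fraction x/s vanishes in X_p exactly when some multiplier outside p kills x. *)
Lemma in_suppP (p : spec R) (X : lmodType R) :
  in_supp p X <-> exists x : X, forall r, r *: x = 0 -> r \in spec_val p.
Proof.
split=> [[z z0]|[x xp]].
  exists (repr z).1 => r rx; apply: contraTT z0 => rp; rewrite negbK.
  rewrite -[z]reprK; apply/frac_eqP; exists r => //=.
  by rewrite scale1r scaler0 scaler0 rx.
exists (\pi_(local_mod p X)%qT (x, denom1 p)); apply/frac_eqP => -[w wp] /=.
by rewrite scale1r !scaler0 => /xp; apply/negP.
Qed.

Lemma subcat_suppP (p : spec R) : subcat_supp M p <->
  exists2 B, M B & exists y : B, forall r, r *: y = 0 -> r \in spec_val p.
Proof. by split=> -[B MB /in_suppP yp]; exists B. Qed.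

Hypothesis R_noeth : noetherian R.

(** For a prime p in the support, some y in a module of M has Ann y inside p, so R/p is a quotient
    of Ry; [ideal_ind] reduces to this case through the extension of R/(I + Ra) by R/(I : a). *)
Lemma serre_quot_ideal (I : submod R^o) :
  (forall p, (forall x : R, I x -> x \in spec_val p) -> subcat_supp M p) ->
  M (quot_mod I).
Proof.
elim/(ideal_ind R_noeth): I => [I I1 _|p I pI Ip|I a IH1 IH2 Ip].
- have [B MB] := serre_nonempty M_serre.
  apply: (serre_quot_mod (g := \0 : {linear R^o -> B})) MB => x _.
  by rewrite -[x]mulr1; exact: idealZ.
- have /subcat_suppP[B MB [y yp]] : subcat_supp M p by apply: Ip => x /pI.
  apply: (serre_quot_mod (g := linear_of (scale_linear y))) MB => x /yp.
  by move=> /pI.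
have h (r : R^o) : colon I a r ->
  (quot_map I \o linear_of (@scale_linear R^o a)) r = 0.
  by move=> h; apply/quot_map_eq0.
have h2 (r : R^o) : I r -> quot_map (adjoin I a) r = 0.
  by move=> Ir; apply/quot_map_eq0; exact: adjoin_sub.
apply: (serre_mid (f := quot_lift h) (g := quot_lift h2)).
- move=> z; have [r <-] := quot_map_ex z; rewrite quot_liftE => /quot_map_eq0.
  move=> [c [i [Ii e]]]; exists (quot_map _ (c : R^o)); rewrite quot_liftE.
  apply/quot_piP; rewrite e /= opprD addrA.
  by rewrite /GRing.scale /= subrr sub0r; exact: submodN.
- by apply: IH1 => p pI; apply: Ip => x Ix; apply: pI; exact: colon_sub.
- by apply: IH2 => p pI; apply: Ip => x Ix; apply: pI; exact: adjoin_sub.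
Qed.

Lemma cyclic_in_supp (X : lmodType R) (x : X) :
  (forall p : spec R, (forall r, r *: x = 0 -> r \in spec_val p) ->
    subcat_supp M p) ->
  cyclic_in x.
Proof.
move=> xp; pose I := ker_sub (linear_of (scale_linear x)).
exists (quot_mod I); first exact: serre_quot_ideal.
exists (quot_map I (1 : R^o)) => r; rewrite -linearZ => /quot_map_eq0 /=.
by rewrite /GRing.scale /= mulr1.
Qed.

End SerreTheory.

(** * Extensions of modules in M by finitely generated modules *)

Section FiniteGeneration.
Variables (R : comPzRingType) (R_noeth : noetherian R).

Lemma lspan_sub (V : lmodType R) (s t : seq V) :
  {subset s <= t} -> forall x, lspan s x -> lspan t x.
Proof. by move=> st; apply: lspan_min => x /st; exact: lspan_mem. Qed.

Definition inter_sub (V : lmodType R) (N P : submod V) : submod V.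
Proof.
exists (fun x => N x /\ P x); first by split; exact: submod_mem0.
by move=> a x y [Nx Px] [Ny Py]; split; exact: submod_memZD.
Defined.

(** The coefficients at e of elements of N form an ideal; lifts of its generators to N, together
    with generators of the intersection of N with the span of s, generate N. *)
Lemma noeth_sub_span (V : lmodType R) (s : seq V) (N : submod V) :
  (forall x, N x -> lspan s x) -> exists t, forall x, N x <-> lspan t x.
Proof.
elim: s N => [|e s IH] N Ns.
  by exists [::] => x; split=> [/Ns //|->]; exact: submod_mem0.
have [x [_ Nx] //|t tP] := IH (inter_sub N (lspan s)).
have h0 : exists w, lspan s w /\ N (0 *: e + w).
  by exists 0; split; [|rewrite scale0r addr0]; exact: submod_mem0.
have hD (a : R) (r r' : R^o) : (exists w, lspan s w /\ N ((r : R) *: e + w)) ->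
    (exists w, lspan s w /\ N ((r' : R) *: e + w)) ->
    exists w, lspan s w /\ N ((a *: r + r' : R^o) *: e + w).
  move=> [w [sw Nw]] [w' [sw' Nw']]; exists (a *: w + w'); split.
    exact: submod_memZD.
  have -> : (a *: r + r' : R^o) *: e + (a *: w + w') =
            a *: ((r : R) *: e + w) + ((r' : R) *: e + w').
    by rewrite scalerDl scalerDr scalerA addrACA.
  exact: submod_memZD.
have [rs rsP] := noeth_span R_noeth (@Submod R R^o _ h0 hD).
have [ns nsN nsP] : exists2 ns : seq V, (forall n, n \in ns -> N n) &
    forall r : R, lspan (V := R^o) rs r ->
      exists w, lspan s w /\ lspan ns (r *: e + w).
  have : forall r : R, r \in rs -> exists w, lspan s w /\ N (r *: e + w).
    by move=> r rrs; apply/(rsP r); exact: (@lspan_mem _ R^o).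
  elim: (rs) => [_|r0 l IHl lN].
    exists [::] => // _ ->; exists 0; rewrite scale0r addr0.
    by split; exact: submod_mem0.
  have [r rl|ns nsN nsP] := IHl; first by apply: lN; rewrite inE rl orbT.
  have [w0 [sw0 Nw0]] := lN r0 (mem_head _ _).
  exists (r0 *: e + w0 :: ns) => [n|_ [c [r' [/nsP[w [sw nw]] ->]]]].
    by rewrite inE => /orP[/eqP->|/nsN].
  exists (c *: w0 + w); split; first exact: submod_memZD.
  exists c, (r' *: e + w); split=> //.
  by rewrite scalerDl scalerDr scalerA addrACA.
exists (ns ++ t) => x; split=> [Nx|]; last first.
  apply: lspan_min => y; rewrite mem_cat => /orP[/nsN //|yt].
  by have /tP[] : lspan t y by exact: lspan_mem.
have [r [y [sy e1]]] := Ns _ Nx.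
have [w [sw nw]] : exists w, lspan s w /\ lspan ns (r *: e + w).
  by apply: nsP; apply/rsP; exists y; rewrite -e1.
have Nw : N (r *: e + w) by exact: lspan_min nw.
have ty : lspan t (y - w).
  apply/tP; split; last exact: submodB.
  have -> : y - w = x - (r *: e + w) by rewrite e1 opprD addrACA subrr add0r.
  exact: submodB.
have -> : x = (r *: e + w) + (y - w) by rewrite e1 [RHS]addrCA addrK addrC.
apply: submodD; [apply: lspan_sub nw|apply: lspan_sub ty] => z zs.
  by rewrite mem_cat zs.
by rewrite mem_cat zs orbT.
Qed.

Variables (M : lmodType R -> Prop) (M_serre : serre M).

(** Replaces the exact sequence by a finite list in X itself, the form in which S_fg * M is used
    below. *)
Lemma fg_extP (X : lmodType R) :
  subcat_ext (@fin_gen R) M X <-> exists s : seq X, M (quot_mod (lspan s)).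
Proof.
split=> [[A [B [f [g [[finj fg gsurj] [t tP] MB]]]]]|[s Ms]].
  exists (map f t); apply: (serre_quot_mod M_serre (g := g)) MB => x.
  move=> /fg[y <-]; have /spansE := tP y.
  suff h : forall z, lspan t z -> preim_sub f (lspan (map f t)) z by move/h.
  by apply: lspan_min => z zt; apply: lspan_mem; exact: map_f.
exists (sub_mod (lspan s)), (quot_mod (lspan s)), (sub_val _), (quot_map _).
split=> //; first split.
- exact: sub_val_inj.
- move=> y; rewrite quot_map_eq0; split=> [/sub_val_ex //|[x <-]].
  exact: sub_valP.
- exact: quot_map_ex.
have h (x : X) : exists y : sub_mod (lspan s), x \in s -> sub_val _ y = x.
  have [xs|_] := boolP (x \in s); last by exists 0.
  by have [y <-] := sub_val_ex (lspan_mem xs); exists y.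
have [k kP] := choice h.
exists (map k s) => x; apply/spansE.
have : lspan s (sub_val _ x) by exact: sub_valP.
suff : forall u, lspan s u -> image_sub (sub_val _) (lspan (map k s)) u.
  by move=> hh /hh[y ky /sub_val_inj <-].
apply: lspan_min => u us; exists (k u); last exact: kP.
by apply: lspan_mem; exact: map_f.
Qed.

Lemma serre_fg_ext : serre (subcat_ext (@fin_gen R) M).
Proof.
have sub_case (A B : lmodType R) (f : {linear A -> B}) : injective f ->
    subcat_ext (@fin_gen R) M B -> subcat_ext (@fin_gen R) M A.
  move=> finj /fg_extP[s Ms]; apply/fg_extP.
  have [|t tP] := @noeth_sub_span B s (image_sub f (preim_sub f (lspan s))).
    by move=> _ [x sx <-].
  have h (y : B) : exists x, y \in t -> preim_sub f (lspan s) x /\ f x = y.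
    have [yt|_] := boolP (y \in t); last by exists 0.
    by have /tP[x sx fx] : lspan t y by [exact: lspan_mem]; exists x.
  have [k kP] := choice h.
  exists (map k t).
  apply: (serre_quot_mod M_serre (g := quot_map (lspan s) \o f)) Ms => x.
  move=> /= /quot_map_eq0 sfx.
  have : lspan t (f x) by apply/tP; exists x.
  suff hh : forall y, lspan t y -> image_sub f (lspan (map k t)) y.
    by move=> /hh[z kz /finj <-].
  apply: lspan_min => y yt; exists (k y); last by have [] := kP y yt.
  by apply: lspan_mem; exact: map_f.
have quot_case (A B : lmodType R) (g : {linear A -> B}) :
    (forall y, exists x, g x = y) ->
    subcat_ext (@fin_gen R) M A -> subcat_ext (@fin_gen R) M B.
  move=> gsurj /fg_extP[s Ms]; apply/fg_extP; exists (map g s).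
  have h x : lspan s x -> (quot_map (lspan (map g s)) \o g) x = 0.
    move=> sx; apply/quot_map_eq0; suff: preim_sub g (lspan (map g s)) x by [].
    by apply: lspan_min sx => z zs; apply: lspan_mem; exact: map_f.
  apply: (serre_quot M_serre (g := quot_lift h)) Ms => z.
  have [y <-] := quot_map_ex z; have [x <-] := gsurj y.
  by exists (quot_map _ x); rewrite quot_liftE.
split=> //.
- have [A MA] := serre_nonempty M_serre; exists A; apply/fg_extP; exists [::].
  by apply: (serre_quot_mod M_serre (g := idfun)) MA.
- by move=> A B f [f' _ ff']; apply: (quot_case _ _ f) => y; exists (f' y);
  exact: ff'.
move=> A B C f g [finj fg gsurj] /fg_extP[s Ms] /fg_extP[t Mt]; apply/fg_extP.
have [k kP] := choice gsurj.
(* Images of the generators in A and lifts of those in C; the quotient of B by them sits between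
   A/span s and C/span t. *)
pose u := map f s ++ map k t; exists u.
have hs x : lspan s x -> (quot_map (lspan u) \o f) x = 0.
  move=> sx; apply/quot_map_eq0; suff: preim_sub f (lspan u) x by [].
  apply: lspan_min sx => z zs; apply: lspan_mem.
  by rewrite mem_cat map_f.
have hu x : lspan u x -> (quot_map (lspan t) \o g) x = 0.
  move=> ux; apply/quot_map_eq0; suff: preim_sub g (lspan t) x by [].
  apply: lspan_min ux => z; rewrite mem_cat => /orP[] /mapP[w wst ->] /=.
    by have /fg -> : exists x, f x = f w by [exists w]; exact: submod_mem0.
  by rewrite kP; exact: lspan_mem.
apply: (serre_mid M_serre (f := quot_lift hs) (g := quot_lift hu)) Ms Mt.
move=> z; have [y <-] := quot_map_ex z; rewrite quot_liftE => /quot_map_eq0 tgy.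
have [w uw gw] : exists2 w, lspan u w & g w = g y.
  suff hh : forall v, lspan t v -> image_sub g (lspan u) v by have [w] :=
    hh _ tgy; exists w.
  apply: lspan_min => v vt; exists (k v); last exact: kP.
  by apply: lspan_mem; rewrite mem_cat map_f ?orbT.
have /fg[x fx] : g (y - w) = 0 by rewrite linearB gw subrr.
exists (quot_map _ x); rewrite quot_liftE; apply/quot_piP.
by rewrite /= fx addrAC subrr sub0r; exact: submodN.
Qed.

End FiniteGeneration.

(** * Injective hulls *)

Section DivisibleGroups.
Variables (B D : lmodType int).
Hypothesis D_div : forall n : nat, (0 < n)%N -> forall d : D,
  exists d', n%:Z *: d' = d.

(** Makes G the graph of a partial additive map from B to D. *)
Definition functional (G : submod (B * D)%type) := forall d, G (0, d) -> d = 0.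

Lemma int_mult_subgroup (P : int -> Prop) :
  P 0 -> (forall m n, P m -> P n -> P (m - n)) ->
  (forall n, P n -> n = 0) \/ exists n0 : nat, [/\ (0 < n0)%N, P n0%:Z &
    forall n, P n -> exists q, n = q * n0%:Z].
Proof.
move=> P0 PB.
have PN n : P n -> P (- n) by move=> Pn; rewrite -sub0r; exact: PB.
have PD m n : P m -> P n -> P (m + n) by move=> Pm /PN Pn; rewrite -[n]opprK;
  exact: PB.
have [[k [k0 Pk]]|nk] := pselect (exists k : nat, (0 < k)%N /\ P k%:Z);
  last first.
  left=> -[[|n]|n] Pn //; first by case: nk; exists n.+1.
  by case: nk; exists n.+1; split=> //; rewrite -[n.+1%:Z]opprK -NegzE;
    exact: PN.
right; have ex : exists k : nat, (0 < k)%N && `[< P k%:Z >].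
  by exists k; rewrite k0; exact/asboolP.
case: (ex_minnP ex) => n0 /andP[n00 /asboolP Pn0] min0; exists n0;
  split=> // n Pn.
exists (n %/ n0)%Z; have nE := divz_eq n n0.
have PZ (q : nat) : P (q%:Z * n0%:Z).
  by elim: q => [|q IH]; rewrite ?mul0r // intS mulrDl mul1r; exact: PD.
have PM (q : int) : P (q * n0%:Z).
  by case: q => q; rewrite ?NegzE ?mulNr; [|apply: PN]; exact: PZ.
suff r0 : (n %% n0)%Z = 0 by rewrite {1}nE r0 addr0.
have Pr : P (n %% n0)%Z.
  have -> : (n %% n0)%Z = n - (n %/ n0)%Z * n0%:Z by rewrite [X in _ = X - _]nE
    addrAC subrr add0r.
  exact: PB.
have n0Z : n0%:Z != 0 by rewrite -lt0n.
have := ltz_pmod n (d := n0%:Z); have := modz_ge0 n n0Z.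
case: (n %% n0)%Z Pr => // -[//|r] Pr _ /(_ n00); rewrite ltz_nat => rn0.
by have := min0 r.+1; rewrite /= leqNgt rn0 => h; have :=
  h (introT (asboolP _) Pr).
Qed.

(** The n with n b in the domain form a subgroup of the integers; if it is generated by n0 > 0,
    dividing the value at n0 b by n0 gives a consistent value at b. *)
Lemma functional_extend (G : submod (B * D)%type) (b : B) : functional G ->
  exists d, functional (adjoin G (b, d)).
Proof.
move=> funG.
have Gx x d d' : G (x, d) -> G (x, d') -> d = d'.
  move=> Gd Gd'; apply/eqP; rewrite -subr_eq0; apply/eqP/funG.
  have -> : (0, d - d') = (x, d) - (x, d') :> B * D.
    by rewrite -[RHS]/(x - x, d - d') subrr.
  exact: submodB.
suff [d dP] : exists d : D, forall n v, G (n *: b, v) -> v = n *: d.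
  exists d => v [n [[y w] [Gyw e]]].
  have [e1 e2] : 0 = n *: b + y /\ v = n *: d + w by move: e => [].
  have : G (n *: b, - w).
    have -> : (n *: b, - w) = - (y, w) :> B * D.
      by rewrite -[RHS]/(- y, - w); congr (_, _); apply/eqP;
        rewrite -addr_eq0 -e1.
    exact: submodN.
  by rewrite e2 => /dP <-; rewrite addNr.
have GB m n v w : G (m *: b, v) -> G (n *: b, w) -> G ((m - n) *: b, v - w).
  by move=> Gm Gn; rewrite scalerBl; exact: (submodB Gm Gn).
have [||h|[n0 [n00 [v0 Gv0] n0P]]] :=
  @int_mult_subgroup (fun n => exists v, G (n *: b, v)).
- by exists 0; rewrite scale0r; exact: submod_mem0.
- by move=> m n [v Gv] [w Gw]; exists (v - w); exact: GB.
- exists 0 => n v Gv; have n0 : n = 0 by apply: h; exists v.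
  by move: Gv; rewrite n0 !scale0r; exact: funG.
have [d dv] := D_div n00 v0.
exists d => n v Gv; have [q nE] := n0P n (ex_intro _ v Gv).
apply: (Gx (n *: b)) => //; rewrite nE -!scalerA dv.
exact: (@submodZ _ _ G q _ Gv0).
Qed.

Lemma additive_extend (G : submod (B * D)%type) : functional G ->
  exists h : {linear B -> D}, forall b d, G (b, d) -> h b = d.
Proof.
move=> funG.
pose P : set (set (B * D)%type) :=
  [set X : set (B * D)%type | exists2 N : submod (B * D)%type, X = N &
    functional N]%classic.
have PG : P G by exists G.
have [F FP totF F0|A [N AN funN] [GA maxA]] := zorn_above PG.
  have [N eN] : exists N : submod (B * D)%type, (\bigcup_(X in F) X)%classic =
    N.
    by apply: chain_union_submod => // X /FP[J ->]; exists J.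
  exists N => // d; rewrite -eN => -[X FX Xd].
  by have [J eJ funJ] := FP _ FX; apply: funJ; rewrite -eJ.
have total b : exists d, N (b, d).
  have [d fd] := functional_extend b funN; exists d.
  suff : A (b, d) by rewrite AN.
  apply: (maxA (adjoin N (b, d))); last exact: adjoin_mem.
    by rewrite AN => x; exact: adjoin_sub.
  by exists (adjoin N (b, d)).
have [h hN] := choice total.
have Nh b d : N (b, d) -> h b = d.
  move=> Nd; apply/eqP; rewrite -subr_eq0; apply/eqP/funN.
  have -> : (0, h b - d) = (b, h b) - (b, d) :> B * D.
    by rewrite -[RHS]/(b - b, h b - d) subrr.
  exact: submodB.
have hL : linear h by move=> a x y; apply: Nh;
  exact: (submod_memZD a (hN x) (hN y)).
by exists (linear_of hL) => b d Gd; apply: Nh; rewrite -AN; exact: GA.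
Qed.

Hypothesis D_tors : forall n : nat, (1 < n)%N -> exists2 d : D, d != 0 &
  n%:Z *: d = 0.

(** It suffices to send x to a nonzero d killed by the order of x, and to extend; for x of infinite
    order any nonzero d serves. *)
Lemma additive_separates (x : B) : x != 0 ->
  exists h : {linear B -> D}, h x != 0.
Proof.
move=> x0.
have [d d0 dP] : exists2 d : D, d != 0 & forall n : int, n *: x = 0 ->
  n *: d = 0.
  have [||h|[n0 [n00 n0x n0P]]] := @int_mult_subgroup (fun n => n *: x = 0).
  - exact: scale0r.
  - by move=> m n mx nx; rewrite scalerBl mx nx subrr.
  - have [d d0 _] := D_tors (isT : 1 < 2)%N; exists d => // n /h ->.
    exact: scale0r.
  have n01 : (1 < n0)%N.
    case: n0 n00 n0x {n0P} => [|[|]] //.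
    by rewrite scale1r => _ x0'; rewrite x0' eqxx in x0.
  have [d d0 nd] := D_tors n01; exists d => // n /n0P[q ->].
  by rewrite -scalerA nd scaler0.
have fun0 : functional (adjoin (sub_bot _) (x, d)).
  move=> e [n [_ [-> ]]]; rewrite addr0 => E.
  have [/esym nx ->] : 0 = n *: x /\ e = n *: d by move: E => [].
  exact: dP.
have [h hP] := additive_extend fun0.
by exists h; rewrite (hP x d) //; exact: adjoin_mem.
Qed.

End DivisibleGroups.

(** * The group Q/Z *)

Section QuotientQZ.

Definition rat_int : submod (zmodule rat : lmodType int).
Proof.
exists (fun x : zmodule rat => exists n : int, x = n%:~R :> rat);
  first by exists 0.
move=> a _ _ [m ->] [n ->]; exists (a * m + n).
by rewrite rmorphD rmorphM /= /GRing.scale /= -mulrzl.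
Defined.

Definition QZ := quot_mod rat_int.

Lemma QZ_div (n : nat) : (0 < n)%N -> forall d : QZ,
  exists d' : QZ, n%:Z *: d' = d.
Proof.
move=> n0 d; have [x <-] := quot_map_ex d.
exists (quot_map rat_int ((x : rat) / n%:R)); rewrite -linearZ;
  congr (quot_map _ _).
rewrite /GRing.scale /= -mulrzl mulrC divfK //.
by rewrite pnatr_eq0 -lt0n.
Qed.

Lemma QZ_tors (n : nat) : (1 < n)%N -> exists2 d : QZ, d != 0 & n%:Z *: d = 0.
Proof.
move=> n1; have n0 : n%:R != 0 :> rat by rewrite pnatr_eq0 -lt0n ltnW.
exists (quot_map rat_int (n%:R^-1 : rat)).
  apply/eqP => /quot_map_eq0[m /esym e].
  have : m%:~R * n%:R = 1 :> rat by rewrite e mulVf.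
  rewrite -[n%:R]/(n%:Z%:~R) -intrM => /eqP;
    rewrite -[1]/(1%:~R) eqr_int => /eqP.
  move=> /(congr1 absz); rewrite abszM /= => /eqP.
  by rewrite muln_eq1 => /andP[_ /eqP n1']; rewrite n1' in n1.
rewrite -linearZ; apply/quot_map_eq0; exists 1.
by rewrite /GRing.scale /= -mulrzl divff.
Qed.

End QuotientQZ.

(** * Coinduced modules and embeddings into injective modules *)

Section Coinduced.
Variables (R : comPzRingType) (K : Type).

(* Hom_Z(R, Q/Z)^K *)
Definition coind_pred : {pred K -> R -> QZ} := fun phi =>
  `[< forall k r s, phi k (r + s) = phi k r + phi k s >].

Lemma coind_zmod_closed : zmod_closed coind_pred.
Proof.
split=> [|phi psi /asboolP phiD /asboolP psiD]; apply/asboolP => k r s.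
  by rewrite -[LHS]/0 -[RHS]/(0 + 0) addr0.
rewrite -[LHS]/(phi k (r + s) - psi k (r + s)) phiD psiD opprD addrACA.
by [].
Qed.

HB.instance Definition _ := GRing.isZmodClosed.Build (K -> R -> QZ) coind_pred
  coind_zmod_closed.

Definition coind := {phi : K -> R -> QZ | phi \in coind_pred}.

HB.instance Definition _ := SubChoice.on coind.
HB.instance Definition _ := [SubChoice_isSubZmodule of coind by <:].

Lemma coindD (phi : coind) k r s : val phi k (r + s) = val phi k r + val phi k
  s.
Proof. by have /asboolP := valP phi; exact. Qed.

Lemma coind_ext (phi psi : coind) :
  (forall k r, val phi k r = val psi k r) -> phi = psi.
Proof. by move=> h; apply: val_inj; apply/funext => k; apply/funext => r. Qed.

Lemma coind_of_subproof (phi : K -> R -> QZ) :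
  (forall k r s, phi k (r + s) = phi k r + phi k s) -> phi \in coind_pred.
Proof. by move=> h; apply/asboolP. Qed.

Definition coind_of phi h : coind := exist _ phi (coind_of_subproof h).

Lemma coind_scale_subproof (a : R) (phi : coind) k r s :
  val phi k ((r + s) * a) = val phi k (r * a) + val phi k (s * a).
Proof. by rewrite mulrDl coindD. Qed.

Definition coind_scale a phi : coind :=
  coind_of (phi := fun k r => val phi k (r * a)) (coind_scale_subproof a phi).

Lemma coind_scaleA a b phi : coind_scale a (coind_scale b phi) = coind_scale
  (a * b) phi.
Proof. by apply: coind_ext => k r /=; rewrite mulrA. Qed.

Lemma coind_scale1 : left_id 1 coind_scale.
Proof. by move=> phi; apply: coind_ext => k r /=; rewrite mulr1. Qed.

Lemma coind_scaleDr : right_distributive coind_scale +%R.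
Proof. by move=> a phi psi; apply: coind_ext. Qed.

Lemma coind_scaleDl phi : {morph coind_scale^~ phi : a b / a + b}.
Proof. by move=> a b; apply: coind_ext => k r; rewrite /= mulrDr coindD. Qed.

HB.instance Definition _ := GRing.Zmodule_isLmodule.Build R coind
  coind_scaleA coind_scale1 coind_scaleDr coind_scaleDl.

Lemma coind_linE (a : R) (phi psi : coind) k r :
  val (a *: phi + psi) k r = val phi k (r * a) + val psi k r.
Proof. by []. Qed.

Lemma coind_scaleE (a : R) (phi : coind) k r :
  val (a *: phi) k r = val phi k (r * a).
Proof. by []. Qed.

(** For each k, a linear map into Hom_Z(R, Q/Z) is determined by its value at 1, an additive map to
    Q/Z. Divisibility extends the latter to some h on B, and b -> (r -> h (r b)) is the required
    linear map. *)
Lemma coind_injective : injective_module (coind : lmodType R).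
Proof.
move=> A B f g finj.
have ext k : exists h : {linear zmodule B -> QZ},
  forall a, h (f a) = val (g a) k 1.
  pose G (u : (zmodule B * QZ)%type) :=
    exists a : A, u = (f a : zmodule B, val (g a) k 1).
  have G0 : G 0 by exists 0; rewrite !linear0.
  have gZ (n : int) a : val (g (a *~ n)) k 1 = n *: val (g a) k 1.
    have -> : g (a *~ n) = g a *~ n by rewrite raddfMz.
    elim/int_ind: n => [|n IH|n IH]; first by rewrite mulr0z scale0r.
      by rewrite intS mulrzDr scalerDl -IH scale1r.
    by rewrite intS opprD mulrzDr scalerDl -IH scaleN1r mulrN1z.
  have GD (n : int) u v : G u -> G v -> G (n *: u + v).
    move=> [a ->] [b ->]; exists (a *~ n + b).
    rewrite linearD /= raddfMz; congr (_, _).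
    by rewrite raddfD /= -gZ.
  have funG : functional (Submod G0 GD).
    move=> d [a [fa ->]]; have -> : a = 0 by apply: finj; rewrite -fa linear0.
    by rewrite linear0.
  have [h hP] := additive_extend QZ_div funG.
  by exists h => a; apply: hP; exists a.
have [h hP] := choice ext.
have hD (b : B) k r s : h k ((r + s) *: b) = h k (r *: b) + h k (s *: b).
  by rewrite scalerDl (linearD (h k)).
pose H b : coind := coind_of (hD b).
have HL : linear H.
  move=> a x y; apply: coind_ext => k r; rewrite coind_linE /=.
  by rewrite scalerDr scalerA (linearD (h k)).
exists (linear_of HL) => a; apply: coind_ext => k r /=.
by rewrite -linearZ hP linearZ coind_scaleE mul1r.
Qed.

End Coinduced.

Section InjectiveHull.
Variable R : comPzRingType.

(** Each x goes to the family of maps r -> k (r x), over all additive k from X to Q/Z; these k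
    separate points. *)
Lemma embed_injective (X : lmodType R) :
  exists (E : lmodType R) (i : {linear X ->
    E}), injective i /\ injective_module E.
Proof.
pose K := {linear zmodule X -> QZ}.
have hD (x : X) (k : K) (r s : R) : k ((r + s) *: x) = k (r *: x) + k (s *: x).
  by rewrite scalerDl (linearD k).
pose i x : coind R K := coind_of (hD x).
have iL : linear i.
  move=> a x y; apply: coind_ext => k r; rewrite coind_linE /=.
  by rewrite scalerDr scalerA (linearD k).
exists (coind R K), (linear_of iL); split; last exact: coind_injective.
move=> x y e; apply/eqP; rewrite -subr_eq0; apply/negPn/negP => xy.
have [k] := additive_separates QZ_div QZ_tors (xy : (x - y : zmodule X) != 0).
move=> /eqP; apply; rewrite linearB; apply/eqP; rewrite subr_eq0; apply/eqP.
have := congr1 (fun phi : coind R K => val phi k 1) e.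
by rewrite /= !scale1r.
Qed.

End InjectiveHull.

(** * Existence of injective hulls and their use for torsion modules *)

Section InjectiveHullExists.
Variable R : comPzRingType.

(** Inside an injective E, take a maximal essential extension N of X and a maximal C meeting N in 0.
    The projection of N + C to N extends to r : E -> E. The image of r is still essential over X, so
    it equals N; thus N is a retract of E, hence injective. *)
Lemma ex_injective_hull (X : lmodType R) :
  exists (E : lmodType R) (i : {linear X -> E}), injective_hull i.
Proof.
have [E [i [iinj Einj]]] := embed_injective X.
pose ess (N : submod E) := forall y, N y -> y != 0 ->
  exists r x, r *: y = i x /\ i x != 0.
pose P : set (set E) :=
  [set Y : set E | exists2 N : submod E, Y = N & ess N]%classic.
have PX : P (image_sub i (sub_top X)).
  by eexists; first reflexivity; move=> _ [x _ <-] x0; exists 1, x;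
    rewrite scale1r.
have [F FP totF F0|A [N AN essN] [XA maxA]] := zorn_above PX.
  have [N eN] : exists N : submod E, (\bigcup_(Y in F) Y)%classic = N.
    by apply: chain_union_submod => // Y /FP[J ->]; exists J.
  exists N => // y; rewrite -eN => -[Y FY Yy].
  by have [J eJ essJ] := FP _ FY; apply: essJ; rewrite -eJ.
have XN x : N (i x) by rewrite -AN; apply: XA; exists x.
pose disj (C : submod E) := forall y, C y -> N y -> y = 0.
pose P' : set (set E) :=
  [set Y : set E | exists2 C : submod E, Y = C & disj C]%classic.
have P'0 : P' (sub_bot E) by eexists; first reflexivity.
have [F FP totF F0|A' [C AC disjC] [_ maxC]] := zorn_above P'0.
  have [C eC] : exists C : submod E, (\bigcup_(Y in F) Y)%classic = C.
    by apply: chain_union_submod => // Y /FP[J ->]; exists J.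
  exists C => // y; rewrite -eC => -[Y FY Yy].
  by have [J eJ disjJ] := FP _ FY; apply: disjJ; rewrite -eJ.
have sumL : linear (fun u : sub_mod N * sub_mod C =>
  sub_val _ u.1 + sub_val _ u.2).
  move=> a u v; rewrite -[(a *: u + v).1]/(a *: u.1 + v.1).
  by rewrite -[(a *: u + v).2]/(a *: u.2 + v.2) !linearP scalerDr addrACA.
have fstL : linear (fun u : sub_mod N * sub_mod C => sub_val _ u.1).
  by move=> a u v; rewrite -[(a *: u + v).1]/(a *: u.1 + v.1) linearP.
have sum_inj : injective (linear_of sumL).
  move=> [u u'] [v v'] /= e.
  have e' : sub_val _ u - sub_val _ v = sub_val _ v' - sub_val _ u'.
    by apply/eqP; rewrite subr_eq addrAC eq_sym subr_eq; apply/eqP;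
      rewrite addrC.
  have Nuv : N (sub_val _ u - sub_val _ v) by apply: submodB; exact: sub_valP.
  have Cuv : C (sub_val _ u - sub_val _ v) by rewrite e'; apply: submodB;
    exact: sub_valP.
  have uv0 := disjC _ Cuv Nuv; congr (_, _).
    by apply: (@sub_val_inj _ _ N); apply/eqP; rewrite -subr_eq0 uv0.
  by apply: (@sub_val_inj _ _ C); apply/eqP; rewrite eq_sym -subr_eq0 -e' uv0.
have [r rP] := Einj _ _ (linear_of sumL) (linear_of fstL) sum_inj.
have rN y : N y -> r y = y.
  move=> /sub_val_ex[z <-]; have := rP (z, 0).
  by rewrite -[linear_of sumL _]/(sub_val N z + sub_val C 0) linear0 addr0.
have rC y : C y -> r y = 0.
  move=> /sub_val_ex[z <-]; have := rP (0, z).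
  rewrite -[linear_of sumL _]/(sub_val N 0 + sub_val C z) linear0 add0r => ->.
  by rewrite -[LHS]/(sub_val N 0) linear0.
have essr : ess (image_sub r (sub_top E)).
  move=> _ [e _ <-] re0.
  (* Otherwise C + Re would still meet N in 0, so e would be in C by maximality and r e would
     vanish. *)
  have [a [c [Cc [z0 Nz]]]] :
    exists a c, C c /\ (a *: e + c != 0 /\ N (a *: e + c)).
    apply: contrapT => h; move/eqP: re0; apply; apply: rC.
    suff : A' e by rewrite AC.
    apply: (maxC (adjoin C e)); last exact: adjoin_mem.
      by rewrite AC => y; exact: adjoin_sub.
    eexists; first reflexivity; move=> _ [a [c [Cc ->]]] Nz.
    by apply/eqP/negPn/negP => z0; apply: h; exists a, c.
  have [b [x [bx x0]]] := essN _ Nz z0; exists (b * a), x; split=> //.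
  rewrite -bx -scalerA; congr (_ *: _).
  by rewrite -[RHS](rN _ Nz) linearD (rC _ Cc) addr0 linearZ.
have rNr y : N (r y).
  suff : A (r y) by rewrite AN.
  apply: (maxA (image_sub r (sub_top E))); last by exists y.
    by rewrite AN => z Nz; exists z => //; exact: rN.
  by eexists; first reflexivity.
exists (sub_mod N), (sub_lift XN); split.
- by move=> x y /(congr1 (sub_val N)); rewrite !sub_liftE => /iinj.
- move=> A0 B0 f g finj; have [h hP] := Einj _ _ f (sub_val N \o g) finj.
  have hN x : N ((r \o h) x) by exact: rNr.
  exists (sub_lift hN) => x; apply: (@sub_val_inj _ _ N);
    rewrite sub_liftE /= hP.
  exact: (rN _ (sub_valP _)).
move=> Y [Y0 YD] [y Yy y0].
have [||b [x [bx x0]]] := essN (sub_val N y).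
- exact: sub_valP.
- by apply: contra_neq y0 => e; apply: (@sub_val_inj _ _ N); rewrite e linear0.
have e : b *: y = sub_lift XN x by apply: (@sub_val_inj _ _ N);
  rewrite sub_liftE -bx linearZ.
exists x; first by rewrite -e -[b *: y]addr0; exact: YD.
by apply: contra_neq x0 => e0; rewrite -(sub_liftE XN x) e0 linear0.
Qed.

Variables (M : lmodType R -> Prop) (M_serre : serre M).
Variable M_hull : closed_injective_hull M.

(** For the least n with I^n x = 0, any nonzero element of I^(n-1) x of the form b x is killed by
    I. *)
Lemma torsion_annihilated (X : lmodType R) (I : {pred R}) (x : X) :
  x \in torsion I -> x != 0 ->
    exists r, r *: x != 0 /\ r *: x \in annihilated I.
Proof.
move=> /asboolP[n _ nx] x0; elim: n nx => [|n IH] nx.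
  by move: x0; rewrite -[x]scale1r nx ?eqxx.
have [h|] := pselect {in ideal_exp I n, forall a, a *: x = 0}; first exact: IH.
move=> /existsNP[b /not_implyP[Ib /eqP bx]]; exists b; split=> //.
apply/asboolP => a Ia; rewrite scalerA; apply: nx; apply/asboolP.
exists [:: (a, b)]; first by rewrite /= Ia Ib.
by rewrite big_seq1.
Qed.

(* A torsion module is an essential extension of (0 : I), so both have the   *)
(* same injective hull.                                                      *)
Lemma melkersson_closed_hull (I : {pred R}) : melkersson_cond M I.
Proof.
move=> X tX MY; have [E [i [iinj Einj iess]]] := ex_injective_hull X.
have valL : linear (val : annih_mod X I -> X) by [].
suff hull : injective_hull (i \o linear_of valL).
  exact: (serre_sub M_serre iinj (M_hull hull MY)).
split=> //.
- by move=> x y /= /iinj/val_inj.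
- move=> N Nclosed /(iess _ Nclosed)[x Nx ix].
  have x0 : x != 0 by apply: contra_neq ix => ->; rewrite linear0.
  have [r [rx rI]] := torsion_annihilated (tX x) x0.
  exists (exist _ (r *: x) rI) => /=.
    case: Nclosed => N0 ND; rewrite linearZ -[X in X \in N]addr0; exact: ND.
  by apply: contra_neq rx => e; apply: iinj; rewrite e linear0.
Qed.

End InjectiveHullExists.

(** * The Melkersson condition *)

Section ColonModules.
Variables (R : comPzRingType) (S : lmodType R -> Prop) (S_serre : serre S).
Variables (X : lmodType R) (L : submod X).

Definition mixed_colon (u v : seq R) : submod X.
Proof.
exists (fun x => (forall a, a \in u -> a *: x = 0) /\ (forall a, a \in v ->
  L (a *: x))).
  by split=> a _; rewrite scaler0 //; exact: submod_mem0.
have sc (c a : R) (x y : X) : a *: (c *: x + y) = c *: (a *: x) + a *: y.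
  by rewrite scalerDr !scalerA mulrC.
move=> c x y [ux vx] [uy vy]; split=> a ha; rewrite sc.
  by rewrite ux // uy // scaler0 addr0.
by apply: submod_memZD; [exact: vx|exact: vy].
Defined.

(** Multiplication by a maps [mixed_colon u (a :: v)] to L with kernel [mixed_colon (a :: u) v];
    moving all generators from v to u in this way ends inside (0 :_X I). *)
Lemma serre_mixed_colon (I : {pred R}) (u v : seq R) :
  (forall x : X, (forall a, a \in u -> a *: x = 0) ->
     (forall a, a \in v -> a *: x = 0) -> x \in annihilated I) ->
  S (sub_mod L) -> S (annih_mod X I) -> S (sub_mod (mixed_colon u v)).
Proof.
move=> + SL SI; elim: v u => [|a v IH] u uvI.
  have hI (x : sub_mod (mixed_colon u [::])) : sub_val _ x \in annihilated I.
    by have [ux _] := sub_valP x; apply: uvI.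
  have fL : linear (fun x => exist _ (sub_val _ x) (hI x) : annih_mod X I).
    by move=> c x y; apply: val_inj.
  apply: (serre_sub S_serre (f := linear_of fL)) SI => x y [e].
  exact: val_inj.
have incl x : mixed_colon (a :: u) v x -> mixed_colon u (a :: v) x.
  move=> [ux vx]; split=> b hb; first by apply: ux; rewrite inE hb orbT.
  move: hb; rewrite inE => /orP[/eqP->|/vx //].
  by rewrite ux ?mem_head //; exact: submod_mem0.
have aL : linear (fun x : sub_mod (mixed_colon u (a :: v)) => a *: sub_val _ x).
  move=> c x y; rewrite (linearP (sub_val (mixed_colon u (a :: v)))).
  by rewrite scalerDr !scalerA mulrC.
have aP x : L (linear_of aL x).
  by have [_] := sub_valP x; apply; exact: mem_head.
have SZ : S (sub_mod (mixed_colon (a :: u) v)).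
  apply: IH => x ux vx; apply: uvI => b hb; first by apply: ux;
    rewrite inE hb orbT.
  by move: hb; rewrite inE => /orP[/eqP->|/vx //]; apply: ux; exact: mem_head.
apply: (serre_mid S_serre (f := sub_incl incl) (g := sub_lift aP)) SZ SL.
move=> y /(congr1 (sub_val L)); rewrite sub_liftE linear0 => ay.
have [uy vy] := sub_valP y.
have [z zy] : exists z : sub_mod (mixed_colon (a :: u) v), sub_val _ z =
  sub_val _ y.
  apply: sub_val_ex; split=> b; last by move=> hb; apply: vy;
    rewrite inE hb orbT.
  by rewrite inE => /orP[/eqP->|/uy].
by exists z; apply: val_inj.
Qed.

Definition colon_mod (I : {pred R}) : submod X.
Proof.
exists (fun x => forall a, a \in I -> L (a *: x)) => [a _|c x y Ix Iy a Ia].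
  by rewrite scaler0; exact: submod_mem0.
rewrite scalerDr scalerA mulrC -scalerA.
by apply: submod_memZD; [exact: Ix|exact: Iy].
Defined.

Lemma serre_colon_mod (R_noeth : noetherian R) (I : {pred R}) : is_ideal I ->
  S (sub_mod L) -> S (annih_mod X I) -> S (sub_mod (colon_mod I)).
Proof.
move=> hI SL SI; have [s sP] := noeth_span R_noeth (ideal_of hI).
have sI a : a \in s -> a \in I.
  by move=> ha; apply/(sP a); exact: (@lspan_mem _ R^o).
apply: (@serre_sub_mod _ _ S_serre _ _ (mixed_colon [::] s)) => [x Ix|].
  by split=> // a /sI/Ix.
apply: serre_mixed_colon SL SI => x _ sx; apply/asboolP => a Ia.
have /sP : ideal_of hI a by [].
by apply: (@lspan_min _ R^o (ker_sub (linear_of (scale_linear x)))) => b /sx.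
Qed.
End ColonModules.

Section IdealPowers.
Variable R : comPzRingType.

Lemma ideal_expX (I : {pred R}) a n : a \in I -> a ^+ n \in ideal_exp I n.
Proof.
move=> Ia; elim: n => [|n IH] //; apply/asboolP; exists [:: (a, a ^+ n)].
  by rewrite /= Ia IH.
by rewrite big_seq1 exprS.
Qed.

Lemma ideal_exp_mul (I : {pred R}) a b n : a \in I -> b \in ideal_exp I n ->
  a * b \in ideal_exp I n.+1.
Proof.
move=> Ia Ib; apply/asboolP; exists [:: (a, b)]; first by rewrite /= Ia Ib.
by rewrite big_seq1.
Qed.

Lemma ideal_exp_principal (I : {pred R}) (x : R) n b :
  (forall a, a \in I -> exists r, a = r * x) ->
  b \in ideal_exp I n -> exists r, b = r * x ^+ n.
Proof.
move=> Ix; elim: n b => [|n IH] b; first by exists b; rewrite mulr1.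
move=> /asboolP[s + ->];
  elim: s => [_|u s IHs /= /andP[/andP[/Ix[r er] /IH[r' er']] /IHs[t et]]].
  by exists 0; rewrite big_nil mul0r.
by exists (r * r' + t); rewrite big_cons et er er' exprS; ring.
Qed.
End IdealPowers.

(** * From height-one primes in the support to the Melkersson condition *)

Section Sufficiency.
Variables (R : comPzRingType) (R_noeth : noetherian R).
Variables (M : lmodType R -> Prop) (M_serre : serre M).
Hypothesis M_hull : closed_injective_hull M.
Notation S := (subcat_ext (@fin_gen R) M).

Lemma serre_fg_ext_right (X : lmodType R) : M X -> S X.
Proof.
move=> MX; apply/(fg_extP M_serre); exists [::].
by apply: (serre_quot_mod M_serre (g := idfun)) MX.
Qed.

Lemma nonminimal_in_supp (p : spec R) :
  (forall P : spec R, height P = 1%:E -> subcat_supp M P) ->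
  ~ minimal_prime p -> subcat_supp M p.
Proof.
move=> h1 /(ex_height1_below R_noeth)[P /h1/subcat_suppP[B MB [y yP]] Pp].
by apply/subcat_suppP; exists B => //; exists y => r /yP/Pp.
Qed.

(** By the Melkersson condition for M it is enough that (0 :_T I) is in M. It is in S_fg * M, and
    its finitely generated part is in M because each element spans a submodule in M. *)
Lemma serre_torsion_in (I : {pred R}) (X : lmodType R) :
  (forall x : X, x \in torsion I) -> S (annih_mod X I) ->
  M (sub_mod (serre_torsion M_serre X)).
Proof.
move=> tX SY; pose T := serre_torsion M_serre X.
apply: (melkersson_closed_hull M_serre M_hull (I := I)).
  move=> x; have /asboolP[n n0 nx] := tX (sub_val T x); apply/asboolP.
  by exists n => // a /nx ax; apply: (@sub_val_inj _ _ T);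
    rewrite linearZ linear0.
pose Y := annih_mod (sub_mod T) I.
have hI (y : Y) : sub_val T (val y) \in annihilated I.
  apply/asboolP => a Ia; have /asboolP/(_ a Ia) := valP y.
  by move=> /(congr1 (sub_val T)); rewrite linearZ linear0.
have fL : linear (fun y => exist _ (sub_val T (val y)) (hI y) : annih_mod X I).
  by move=> c x y; apply: val_inj.
have : S Y.
  apply: (serre_sub (serre_fg_ext R_noeth M_serre) (f := linear_of fL)) SY =>
    x y [e].
  by apply/val_inj/val_inj.
move=> /(fg_extP M_serre)[s Ms].
have My (y : Y) : cyclic_in M y.
  have [B MB [b bP]] := sub_valP (val y); exists B => //; exists b => r /bP rb.
  by apply/val_inj/val_inj.
apply: (serre_mid M_serre (f := sub_val (lspan s)) (g :=
  quot_map (lspan s))) Ms.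
  by move=> y /quot_map_eq0/sub_val_ex.
exact: serre_lspan.
Qed.

Lemma fg_ext_melkersson :
  (forall P : spec R, height P = 1%:E -> subcat_supp M P) ->
  melkersson S.
Proof.
move=> h1; split=> [|I hI X tX SY]; first exact: serre_fg_ext.
have S_serre := serre_fg_ext R_noeth M_serre.
pose T := serre_torsion M_serre X.
have ST : S (sub_mod T) by exact/serre_fg_ext_right/(serre_torsion_in tX SY).
(* This is (T :_X I^n), built one factor of I at a time. *)
pose Tn n := iter n (fun L => colon_mod L I) T.
have STn n : S (sub_mod (Tn n)).
  by elim: n => [|n IH] //=; exact: serre_colon_mod.
have TnP n (x : X) : (forall b, b \in ideal_exp I n -> T (b *: x)) -> Tn n x.
  elim: n x => [|n IH] x hx; first by rewrite -[x]scale1r; exact: hx.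
  move=> a Ia; apply: IH => b Ib; rewrite scalerA mulrC; apply: hx.
  exact: ideal_exp_mul.
have [l lI _] := ex_primes_prod R_noeth (sub_bot R^o).
have topT x : Tn (size l) x.
  apply: TnP => b Ib; apply/serre_torsionE; apply: cyclic_in_supp => // p annp.
  apply: nonminimal_in_supp => // minp.
  (* A minimal p cannot contain Ann(b x): if I is inside p, a multiplier outside p kills b, as b is
     in I^N; otherwise a power of some a in I outside p kills x. *)
  have [Ip|/existsNP[a /not_implyP[Ia /negP pa]]] := pselect {subset I <= p}.
    have [s sp sP] := minimal_prime_ann Ip minp lI.
    have := annp s; rewrite scalerA (sP _ Ib) scale0r => /(_ erefl).
    exact/negP.
  have /asboolP[n _ nx] := tX x; apply: (negP pa); apply: (@spec_memX _ _ _ n).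
  by apply: annp; rewrite scalerA mulrC -scalerA nx ?scaler0 //;
    exact: ideal_expX.
apply: (serre_quot S_serre (g := sub_val (Tn (size l)))) (STn _) => x.
exact: sub_val_ex.
Qed.

End Sufficiency.

(** * From the Melkersson condition to the support *)

Section Necessity.
Variables (R : comPzRingType) (M : lmodType R -> Prop) (M_serre : serre M).
Notation S := (subcat_ext (@fin_gen R) M).

(** R_q as an R-module with its element 1, reduced to what the construction of D[1/x]/D uses. *)
Lemma ex_localization (q : spec R) : exists (F : lmodType R) (one : F),
  (forall r : R, r *: one = 0 -> r \in spec_val q) /\
  (forall s : R, s \notin spec_val q -> exists u, s *: u = one).
Proof.
pose F := local_mod q R^o.
pose one : F := (\pi_(local_mod q R^o) ((1 : R^o), denom1 q))%qT.
exists F, one; split=> [r|s sq].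
  rewrite -[r *: one]/(local_scale r one) local_scaleE => /eqP/frac_eqP[w wq].
  rewrite /= /GRing.scale /= !mul1r !mulr0 mulr1 => e.
  have : w * r \in spec_val q by rewrite e; exact: spec_mem0.
  by move=> /spec_mem_mul/orP[wq'|//]; rewrite wq' in wq.
exists (\pi_(local_mod q R^o) ((1 : R^o), exist _ s sq : denom q))%qT.
rewrite -[LHS]/(local_scale s _) local_scaleE; apply/eqP/frac_eqP.
by exists 1; [exact: spec_proper|rewrite /= /GRing.scale /= !mul1r].
Qed.

(* D[1/x]/D, for D = R/q, is realized as the x-torsion of R_q/(R + q R_q);    *)
(* the predicate mD below is R + q R_q.                                       *)
Lemma melkersson_supp (p q : spec R) :
  melkersson S -> strict_sub q p -> subcat_supp M p.
Proof.
move=> [S_serre melkS] [qp npq].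
have [x /not_implyP[px /negP qx]] :
  exists x, ~ (x \in spec_val p -> x \in spec_val q).
  exact/existsNP.
have [F [one [one0 divs]]] := ex_localization q.
have qX n : x ^+ n \notin spec_val q by apply: contra qx; exact: spec_memX.
pose mD (z : F) := exists a s b : R,
  [/\ s \notin spec_val q, b \in spec_val q & s *: z = (s * a + b) *: one].
have mD0 : mD 0.
  exists 0, 1, 0; split; [exact: spec_proper|exact: spec_mem0|].
  by rewrite scaler0 mulr0 addr0 scale0r.
have mDD (c : R) (z w : F) : mD z -> mD w -> mD (c *: z + w).
  move=> [a [s [b [sq qb e]]]] [a' [s' [b' [sq' qb' e']]]].
  exists (c * a + a'), (s * s'), (s' * c * b + s * b'); split.
  - exact: spec_complM.
  - by apply: spec_memD; exact: spec_memM.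
  - have -> : (s * s') *: (c *: z + w) = (s' * c) *: (s *: z) + s *: (s' *: w).
      by rewrite scalerDr !scalerA; congr (_ *: _ + _ *: _); ring.
    by rewrite e e' !scalerA -scalerDl; congr (_ *: _); ring.
pose D : submod F := Submod mD0 mDD.
pose Q : lmodType R := quot_mod D.
pose mT (z : Q) := exists n, x ^+ n *: z = 0.
have mT0 : mT 0 by exists 0%N; rewrite scaler0.
have mTD (c : R) z w : mT z -> mT w -> mT (c *: z + w).
  move=> [n nz] [m mw]; exists (n + m)%N.
  have -> : x ^+ (n + m) *: (c *: z + w) =
     (x ^+ m * c) *: (x ^+ n *: z) + x ^+ n *: (x ^+ m *: w).
    by rewrite scalerDr !scalerA exprD; congr (_ *: _ + _ *: _); ring.
  by rewrite nz mw !scaler0 addr0.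
pose T : submod Q := Submod mT0 mTD.
pose X : lmodType R := sub_mod T.
pose I : submod R^o := adjoin (sub_bot R^o) x.
pose Ip : {pred R} := submod_pred I.
have Ix (a : R) : a \in Ip -> exists r, a = r * x.
  by move=> /submod_predP[r [_ [-> ->]]]; exists r; rewrite addr0.
have piZ (a : R) (w : F) : quot_map D (a *: w) = a *: quot_map D w.
  exact: linearZ.
have valZ (a : R) (z : X) : sub_val T (a *: z) = a *: sub_val T z by [].
have XT (z : X) : z \in torsion Ip.
  have [n nz] := sub_valP z; apply/asboolP; exists n.+1 => // b Ib.
  have [r ->] := ideal_exp_principal Ix Ib.
  apply: (@sub_val_inj _ _ T); rewrite valZ linear0 exprS mulrA -scalerA.
  by rewrite nz scaler0.
(* u = 1/x^n in F *)
have inv n : exists u : F, x ^+ n *: u = one by exact/divs/qX.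
have invT n u : x ^+ n *: u = one -> T (quot_map D u).
  move=> xu; exists n; rewrite -linearZ xu; apply/quot_map_eq0.
  exists 1, 1, 0; split; [exact: spec_proper|exact: spec_mem0|].
  by rewrite addr0 mulr1.
have SY : S (annih_mod X Ip).
  have [u xu] := inv 1%N; have [e eu] := sub_val_ex (invT _ _ xu).
  have eI : e \in annihilated Ip.
    apply/asboolP => a /Ix[r ->]; apply: (@sub_val_inj _ _ T).
    rewrite valZ linear0 eu -linearZ -scalerA -[x in x *: u]expr1 xu.
    apply/quot_map_eq0; exists r, 1, 0; split;
      [exact: spec_proper|exact: spec_mem0|].
    by rewrite addr0 mul1r scale1r.
  (* The class e of 1/x generates (0 :_X I), so the quotient is zero: if x w = a + b/s with b in q,
     then w - a/x = b/(s x) is in q R_q. *)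
  apply/(fg_extP M_serre); exists [:: exist _ e eI].
  have [B MB] := serre_nonempty M_serre.
  apply: (serre_quot_mod M_serre (g := \0 : {linear annih_mod X Ip -> B})) MB.
  move=> y _; have [w wy] := quot_map_ex (sub_val T (val y)).
  have : x *: val y = 0.
    have /asboolP := valP y; apply; apply/submod_predP; exact: adjoin_mem.
  move=> /(congr1 (sub_val T)); rewrite valZ linear0 -wy -linearZ.
  move=> /quot_map_eq0[a [s [b [sq qb e1]]]].
  exists a, 0; split=> //; rewrite addr0; apply: val_inj;
    apply: (@sub_val_inj _ _ T).
  rewrite -wy -[RHS]/(a *: sub_val T e) eu -linearZ; apply/quot_piP.
  exists 0, (s * x), b; split=> //; first exact: spec_complM.
  have -> : (s * x) *: (w - a *: u) = s *: (x *: w) - (s * a) *: (x ^+ 1 *: u).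
    by rewrite scalerBr !scalerA expr1; congr (_ *: _ - _ *: _); ring.
  by rewrite e1 xu -scalerBl mulr0 add0r addrAC subrr add0r.
have /(fg_extP M_serre)[t Mt] : S X := melkS _ (submod_pred_closed I) _ XT SY.
have [n tn] : exists n, forall z, lspan t z -> x ^+ n *: z = 0.
  have [n tn] : exists n, forall z, z \in t -> x ^+ n *: z = 0.
    elim: (t) => [|z t' [n tn]]; first by exists 0%N.
    have [m mz] := sub_valP z; exists (n + m)%N => y.
    rewrite inE exprD => /orP[/eqP->|/tn]; last first.
      by rewrite mulrC -scalerA => ->; rewrite scaler0.
    apply: (@sub_val_inj _ _ T); rewrite -scalerA.
    by rewrite !valZ linear0 mz scaler0.
  have xL : linear (fun z : X => x ^+ n *: z).
    by move=> c z w; rewrite scalerDr !scalerA mulrC.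
  by exists n; apply: (@lspan_min _ _ (ker_sub (linear_of xL))).
(* The exponent n + 1 leaves one x in the denominator: if r e is in the span of t, then x^n r e = 0,
   so r/x is in R + q R_q and r is in xR + q. *)
have [u xu] := inv n.+1; have [e eu] := sub_val_ex (invT _ _ xu).
apply/subcat_suppP; exists (quot_mod (lspan t)) => //.
exists (quot_map (lspan t) e) => r; rewrite -linearZ => /quot_map_eq0/tn.
move=> /(congr1 (sub_val T)); rewrite !valZ linear0 eu -(piZ r) -piZ.
move=> /quot_map_eq0[a [s [b [sq qb e1]]]].
have : (s * r - x * (s * a + b)) *: one = 0.
  suff e2 : (x * (s * a + b)) *: one = (s * r) *: one by rewrite scalerBl e2
    subrr.
  by rewrite -scalerA -e1 -xu !scalerA exprS; congr (_ *: _); ring.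
move=> /one0 h.
have : s * (r - x * a) \in spec_val q.
  apply: (@spec_memDr _ _ _ (- (x * b))).
    by rewrite -mulrN; apply: spec_memM;
      exact: (@submodN R R^o (prime_ideal q) b).
  by have -> : s * (r - x * a) + - (x * b) = s * r - x * (s * a + b) by ring.
move=> /spec_mem_mul/orP[sq'|/qp h']; first by rewrite sq' in sq.
rewrite -(subrK (x * a) r); apply: spec_memD => //; exact: spec_memMr.
Qed.

End Necessity.

Theorem theorem4p1 (R : comPzRingType) (R_noeth : noetherian R)
    (M : lmodType R -> Prop) (M_serre : serre M)
    (M_hull : closed_injective_hull M) :
  melkersson (subcat_ext (@fin_gen R) M) <->
  (krull_dim R = 0%:E \/
   forall p : spec R, height p = 1%:E -> subcat_supp M p).
Proof.
split=> [melkS|h].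
  right=> p /height1_strict[q qp]; exact: melkersson_supp melkS qp.
apply: fg_ext_melkersson => // p hp; case: h => [d0|]; last exact.
by case: (dim0_no_height1 d0 hp).
Qed.
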